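(* Let $d\ge 2$, let $Q$ be a quadratic form on $\mathbb{R}^d$, let $v\in\mathbb{R}^d$, $\rho\in\mathbb{R}$, and let $S=\{x\in\mathbb{R}^d : Q(x)+2\langle v,x\rangle=\rho\}$. Then there exists an exceptional set $\mathcal{E}=\mathcal{E}(Q,v,\rho)\subseteq \mathbb{S}^{d-1}\times\mathbb{S}^{d-1}$ of pairs of distinct directions such that: (i) $\mathcal{E}$ has measure zero with respect to the surface measure on $\mathbb{S}^{d-1}\times\mathbb{S}^{d-1}$; (ii) whenever $u_1,u_2\in\mathbb{S}^{d-1}$ are distinct directions (that is, $u_1\neq\pm u_2$) with $Q(u_1)\neq 0$, $Q(u_2)\neq 0$ and $(u_1,u_2)\notin\mathcal{E}$, the pair $(S,H_{u_1}\cup H_{u_2})$ is a Heisenberg uniqueness pair.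
   Context: For a finite Borel measure $\mu$ on $\mathbb{R}^d$, its Fourier transform is $\widehat{\mu}(\xi)=\int_{\mathbb{R}^d}e^{i\langle x,\xi\rangle}\,d\mu(x)$, $\xi\in\mathbb{R}^d$. For a measurable set $S\subseteq\mathbb{R}^d$, $\mathcal{M}(S)$ denotes the set of finite signed Borel measures supported in $S$. For measurable sets $S,\Lambda\subseteq\mathbb{R}^d$, the pair $(S,\Lambda)$ is a Heisenberg uniqueness pair if the only $\mu\in\mathcal{M}(S)$ with $\widehat{\mu}=0$ on $\Lambda$ is $\mu=0$. For $u\in\mathbb{R}^d$ with $|u|=1$, $H_u=\{x\in\mathbb{R}^d:\langle x,u\rangle=0\}$. $\mathbb{S}^{d-1}$ is the unit sphere of $\mathbb{R}^d$. *)

(* Defs.v *)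
From HB Require Import structures.
From mathcomp Require Import all_boot all_order all_algebra.
From mathcomp Require Import complex lra.
From mathcomp Require Import all_classical all_reals all_analysis.
From mathcomp Require Import measurable_realfun.

Set Implicit Arguments.
Unset Strict Implicit.
Unset Printing Implicit Defensive.

Import Order.TTheory GRing.Theory Num.Theory.
Import numFieldNormedType.Exports.

Local Open Scope classical_set_scope.
Local Open Scope ring_scope.

(* The space of row vectors with its Borel sigma-algebra, the one generated by
   the open sets of the product topology. *)
Definition Rd (R : realType) (d : nat) :=
  g_sigma_algebraType (@open 'rV[R]_d).

HB.instance Definition _ (R : realType) (d : nat) := Measurable.on (Rd R d).

Definition dot (R : realType) (d : nat) (x y : 'rV[R]_d) : R :=
  \sum_(i < d) x 0 i * y 0 i.

(* The Euclidean norm; the library norm `|x| on matrices is the max-norm. *)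
Definition enorm (R : realType) (d : nat) (x : 'rV[R]_d) : R :=
  Num.sqrt (dot x x).

Definition sphere (R : realType) (d : nat) : set 'rV[R]_d :=
  [set u | enorm u = 1].

Definition hyperplane (R : realType) (d : nat) (u : 'rV[R]_d) : set 'rV[R]_d :=
  [set x | dot x u = 0].

Definition is_quadratic_form (R : realType) (d : nat) (Q : 'rV[R]_d -> R) :=
  exists B : {symmetric 'rV[R]_d}, forall x, Q x = B x x.

Definition quadric (R : realType) (d : nat) (Q : 'rV[R]_d -> R)
    (v : 'rV[R]_d) (rho : R) : set 'rV[R]_d :=
  [set x | Q x + 2 * dot v x = rho].

Section fourier.
Local Open Scope charge_scope.
Context (R : realType) (d : nat).
Implicit Type mu : {charge set (Rd R d) -> \bar R}.

(* Integral against a finite signed measure, through its Jordan decomposition;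
   by uniqueness of the latter the chosen Hahn decomposition is irrelevant. *)
Definition charge_integral mu (f : Rd R d -> R) : R :=
  let hahnP := cid (Hahn_decomposition mu) in
  let hahnPN := projT2 (cid (projT2 hahnP)) in
  \int[jordan_pos hahnPN]_x f x - \int[jordan_neg hahnPN]_x f x.

Definition fourier mu (xi : 'rV[R]_d) : R[i] :=
  (charge_integral mu (fun x => cos (dot x xi))
   +i* charge_integral mu (fun x => sin (dot x xi)))%C.

(* mu is supported in S when every Borel set disjoint from S is mu-null. *)
Definition heisenberg_uniqueness_pair (S L : set (Rd R d)) : Prop :=
  [/\ measurable S, measurable L &
    forall mu, mu.-null_set (~` S) ->
      (forall xi, L xi -> fourier mu xi = 0) ->
      forall A, measurable A -> mu A = 0%E].

End fourier.

Section borel_rV.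
Context (R : realType).

Lemma open_measurable_rV n (U : set (Rd R n)) :
  open (U : set 'rV[R]_n) -> measurable U.
Proof. by move=> oU; exact: sub_sigma_algebra. Qed.

Lemma measurable_coord n (i : 'I_n) :
  measurable_fun setT (fun x : Rd R n => x 0 i : R).
Proof.
apply: (measurability _ (RGenOpens.measurableE R)).
move=> _ [_ [a [b ->]] <-]; rewrite setTI; apply: open_measurable_rV.
have /continuousP := @coord_continuous R 1 n 0 i; apply.
exact: interval_open.
Qed.

Lemma measurable_box n (a b : 'rV[R]_n) :
  measurable ([set x : 'rV[R]_n | forall i, x 0 i \in `]a 0 i, b 0 i]]
              : set (Rd R n)).
Proof.
rewrite (_ : [set _ | _] = \bigcap_(i in [set: 'I_n])
    ((fun x : Rd R n => (x : 'rV[R]_n) 0 i : R) @^-1` `]a 0 i, b 0 i])).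
  apply: fin_bigcap_measurable => [|i _]; first exact: finite_finset.
  rewrite -[X in measurable X]setTI.
  exact: (@measurable_coord n i measurableT _ (measurable_itv _)).
by apply/seteqP; split => [x xB i _|x xB i]; [exact: xB|exact: (xB i)].
Qed.

Lemma measurable_rV d' (T : measurableType d') n (f : T -> Rd R n) :
  (forall i, measurable_fun setT (fun t => f t 0 i : R)) ->
  measurable_fun setT f.
Proof.
move=> mf; apply: (@measurability _ _ _ (Rd R n) _ _ (@open 'rV[R]_n)) => //.
move=> _ [U oU <-]; rewrite setTI.
pose box (ab : 'rV[rat]_n * 'rV[rat]_n) : set 'rV[R]_n :=
  [set x | forall i, x 0 i \in `]ratr (ab.1 0 i), ratr (ab.2 0 i)[].
have -> : f @^-1` U = \bigcup_ab
    (if `[< box ab `<=` U >] then f @^-1` box ab else set0).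
  apply/seteqP; split => [t Ut|t [ab _]]; last first.
    by case: asboolP => // abU /abU.
  move: oU; rewrite openE => /(_ _ Ut)/nbhs_ballP[e /= e0 eU].
  have ha i : exists q : rat, ratr q \in `](f t 0 i - e)%R, (f t 0 i : R)[.
    by apply: rat_in_itvoo; rewrite ltrBlDr ltrDl.
  have hb i : exists q : rat, ratr q \in `](f t 0 i : R), (f t 0 i + e)%R[.
    by apply: rat_in_itvoo; rewrite ltrDl.
  pose a i := projT1 (cid (ha i)); pose b i := projT1 (cid (hb i)).
  have aP i : ratr (a i) \in `](f t 0 i - e)%R, (f t 0 i : R)[.
    exact: projT2 (cid (ha i)).
  have bP i : ratr (b i) \in `](f t 0 i : R), (f t 0 i + e)%R[.
    exact: projT2 (cid (hb i)).
  exists (\row_i a i, \row_i b i) => //.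
  rewrite ifT; last first.
    apply/asboolP => x xab; apply: eU; split => // i j.
    rewrite (ord1 i) /ball /= distrC ltr_distl.
    have := xab j; rewrite /= !mxE; move: (aP j) (bP j); rewrite !in_itv/=.
    move=> /andP[a1 a2] /andP[b1 b2] /andP[x1 x2].
    by rewrite (lt_trans a1 x1) (lt_trans x2 b2).
  move=> i /=; rewrite !mxE; move: (aP i) (bP i); rewrite !in_itv/=.
  by move=> /andP[_ ->] /andP[->].
apply: countable_bigcupT_measurable => [|ab]; first exact: countableP.
case: asboolP => // _.
have -> : f @^-1` box ab = \bigcap_(i in [set: 'I_n])
    ((fun t => f t 0 i : R) @^-1` `]ratr (ab.1 0 i), ratr (ab.2 0 i)[).
  apply/seteqP; split => [t tb i _|t tb i]; first exact: tb.
  exact: tb.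
apply: fin_bigcap_measurable => [|i _]; first exact: finite_finset.
by rewrite -[X in measurable X]setTI; apply: mf => //; exact: measurable_itv.
Qed.

Lemma measurable_dot n :
  measurable_fun setT (fun x : Rd R n => dot (x : 'rV[R]_n) x).
Proof.
apply: measurable_sum => i.
by apply: measurable_funM; exact: measurable_coord.
Qed.

Lemma measurable_enorm n : measurable_fun setT (@enorm R n : Rd R n -> R).
Proof.
apply: (@measurableT_comp _ _ _ _ _ _ (@Num.sqrt R)); last exact: measurable_dot.
by apply: continuous_measurable_fun; exact: sqrt_continuous.
Qed.

Definition direction n (x : Rd R n) : Rd R n :=
  (enorm x)^-1 *: (x : 'rV[R]_n).

Lemma measurable_direction n : measurable_fun setT (@direction n).
Proof.
apply: measurable_rV => i.
rewrite (_ : (fun _ => _) =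
  (fun x : Rd R n => (enorm x) `^ (-1) * (x 0 i : R))); last first.
  by apply/funext => x; rewrite mxE powR_inv1// sqrtr_ge0.
apply: measurable_funM; last exact: measurable_coord.
apply: (@measurableT_comp _ _ _ _ _ _ (@powR R ^~ (-1))).
  exact: measurable_powR.
exact: measurable_enorm.
Qed.

End borel_rV.

Section lebesgue.
Local Open Scope ereal_scope.
Context (R : realType).

Definition cons_rV n (p : measurableTypeR R * Rd R n) : Rd R n.+1 :=
  row_mx (p.1%:M : 'M[R]_1) (p.2 : 'rV[R]_n).

Lemma cons_rV0 n p : (@cons_rV n p : 'rV[R]_n.+1) 0%R 0%R = p.1.
Proof.
have i0 : (0%R : 'I_n.+1) = lshift n (0%R : 'I_1) by exact/val_inj.
by rewrite i0 [LHS]row_mxEl mxE eqxx.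
Qed.

Lemma cons_rVS n p i :
  (@cons_rV n p : 'rV[R]_n.+1) 0%R (lift 0%R i) = (p.2 : 'rV[R]_n) 0%R i.
Proof.
have i1 : lift (0%R : 'I_n.+1) i = rshift 1 i by exact/val_inj.
by rewrite i1 [LHS]row_mxEr.
Qed.

Lemma measurable_cons_rV n : measurable_fun setT (@cons_rV n).
Proof.
apply: measurable_rV => i.
have [->|[j ->]] : i = 0%R \/ exists j, i = lift 0%R j.
  by case: (unliftP 0%R i) => [j ->|->]; [right; exists j|left].
  under eq_fun do rewrite cons_rV0.
  exact: measurable_fst.
under eq_fun do rewrite cons_rVS.
exact: (measurableT_comp (@measurable_coord R n j) measurable_snd).
Qed.

Definition uncons_rV n (x : Rd R n.+1) : measurableTypeR R * Rd R n :=
  ((x : 'rV[R]_n.+1) 0%R 0%R, \row_i (x : 'rV[R]_n.+1) 0%R (lift 0%R i)).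

Lemma cons_rVK n : cancel (@cons_rV n) (@uncons_rV n).
Proof.
move=> [a x]; rewrite /uncons_rV cons_rV0; congr pair.
by apply/rowP => i; rewrite mxE cons_rVS.
Qed.

Lemma measurable_uncons_rV n : measurable_fun setT (@uncons_rV n).
Proof.
apply: measurable_fun_pair; first exact: measurable_coord.
apply: measurable_rV => i; under eq_fun do rewrite mxE.
exact: measurable_coord.
Qed.

Section cons_measure.
Context n (m : {sigma_finite_measure set (Rd R n) -> \bar R}).

Definition cons_measure : set (Rd R n.+1) -> \bar R :=
  pushforward (lebesgue_measure \x m) (@cons_rV n).

Let P : {measure set (Rd R n.+1) -> \bar R} :=
  @measure_function_pushforward__canonical__measure_function_Measure
    _ _ _ _ _ (lebesgue_measure \x m) _ (@measurable_cons_rV n).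

HB.instance Definition _ := Measure.copy cons_measure P.

Let cons_measure_sigma_finite : sigma_finite setT cons_measure.
Proof.
have /sigma_finiteP[F [FT ndF Foo]] := sigma_finiteT (@lebesgue_measure R).
have /sigma_finiteP[G [GT ndG Goo]] := sigma_finiteT m.
exists (fun k => @uncons_rV n @^-1` (F k `*` G k)) => [|k].
  apply/seteqP; split => // x _.
  have [i _ Fi] : (\bigcup_i F i) (uncons_rV x).1 by rewrite -FT.
  have [j _ Gj] : (\bigcup_i G i) (uncons_rV x).2 by rewrite -GT.
  exists (maxn i j) => //; split.
    by move: Fi; exact/subsetPset/ndF/leq_maxl.
  by move: Gj; exact/subsetPset/ndG/leq_maxr.
have [mF Fk] := Foo k; have [mG Gk] := Goo k.
split.
  rewrite -[X in measurable X]setTI; apply: measurable_uncons_rV => //.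
  exact: measurableX.
rewrite /cons_measure /pushforward -comp_preimage.
rewrite (_ : _ @^-1` _ = F k `*` G k).
  by rewrite product_measure1E// lte_mul_pinfty// ge0_fin_numE.
by rewrite (_ : _ \o _ = id)//; apply/funext => p; exact: cons_rVK.
Qed.

HB.instance Definition _ := @Measure_isSigmaFinite.Build _ _ _ cons_measure
  cons_measure_sigma_finite.

End cons_measure.

Fixpoint lebesgue_rV n : {sigma_finite_measure set (Rd R n) -> \bar R} :=
  match n with
  | 0 => [the {sigma_finite_measure set (Rd R 0) -> \bar R} of \d_(0%R : Rd R 0)]
  | n'.+1 => [the {sigma_finite_measure set (Rd R n'.+1) -> \bar R} of
               cons_measure (lebesgue_rV n')]
  end.

Lemma lebesgue_rV_box n (a b : 'rV[R]_n) : (forall i, a 0 i <= b 0 i)%R ->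
  lebesgue_rV n [set x : 'rV[R]_n | forall i, x 0%R i \in `]a 0%R i, b 0%R i]]
  = (\prod_(i < n) (b 0 i - a 0 i))%:E.
Proof.
elim: n a b => [|n IH] a b ab /=.
  rewrite big_ord0 diracE mem_set//=; first by case.
rewrite /cons_measure /pushforward.
pose a' : 'rV[R]_n := \row_i a 0%R (lift 0%R i).
pose b' : 'rV[R]_n := \row_i b 0%R (lift 0%R i).
pose B : set (Rd R n) := [set x : 'rV[R]_n | forall i,
  x 0%R i \in `]a' 0%R i, b' 0%R i]].
rewrite (_ : _ @^-1` _ = `]a 0%R 0%R, b 0%R 0%R]%classic `*` B); last first.
  apply/seteqP; split => [p px|p [p1 p2] i] /=.
    split => /=; first by have := px 0%R; rewrite cons_rV0.
    by move=> i; have := px (lift 0%R i); rewrite cons_rVS !mxE.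
  case: (unliftP 0%R i) => [j ->|->]; last by rewrite cons_rV0.
  by rewrite cons_rVS; have := p2 j; rewrite !mxE.
have mB : measurable B by exact: measurable_box.
rewrite product_measure1E//= IH; last by move=> i; rewrite !mxE.
rewrite lebesgue_measure_itv/= lte_fin big_ord_recl EFinM.
congr (_ * _); last by congr EFin; apply: eq_bigr => i _; rewrite !mxE.
case: ltP => // ba; rewrite (_ : b 0%R 0%R = a 0%R 0%R) ?subrr//.
by apply/eqP; rewrite eq_le ba ab.
Qed.

Section surface_measure.
Context (n : nat).

(* Surface measure of the unit sphere in polar coordinates: n times the
   Lebesgue measure of the cone { r u | 0 < r <= 1, u in A }.  It is a Borel
   measure on the ambient space, carried by the sphere. *)
Definition surface_measure (A : set (Rd R n)) : \bar R :=
  n%:R%:E * lebesgue_rV n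
    [set x : 'rV[R]_n | (0 < enorm x <= 1)%R /\ A ((enorm x)^-1 *: x)%R].

Let D : set (Rd R n) := [set x : 'rV[R]_n | (0 < enorm x <= 1)%R].

Let mD : measurable D.
Proof.
rewrite (_ : D = @enorm R n @^-1` `]0%R, 1%R]); last first.
  by apply/seteqP; split => x /=; rewrite in_itv.
rewrite -[X in measurable X]setTI; apply: measurable_enorm => //.
Qed.

Let P : {measure set (Rd R n) -> \bar R} :=
  mscale (NngNum (ler0n R n))
   (@measure_function_pushforward__canonical__measure_function_Measure
    _ _ _ _ _ (mrestr (lebesgue_rV n) mD) _ (@measurable_direction R n)).

Let surface_measureE : surface_measure = P.
Proof.
apply/funext => A; rewrite /= /mscale/= /surface_measure; congr (_ * _).
by rewrite /pushforward /mrestr; congr (lebesgue_rV n _); rewrite setIC.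
Qed.

Let surface_measure0 : surface_measure set0 = 0.
Proof. by rewrite surface_measureE measure0. Qed.

Let surface_measure_ge0 A : 0 <= surface_measure A.
Proof. by rewrite surface_measureE. Qed.

Let surface_measure_sigma_additive : semi_sigma_additive surface_measure.
Proof. by rewrite surface_measureE; exact: measure_semi_sigma_additive. Qed.

HB.instance Definition _ := isMeasure.Build _ _ _ surface_measure
  surface_measure0 surface_measure_ge0 surface_measure_sigma_additive.

Let surface_measure_finite : fin_num_fun surface_measure.
Proof.
move=> A mA; rewrite ge0_fin_numE; last exact: surface_measure_ge0.
pose a : 'rV[R]_n := const_mx (-2)%R; pose b : 'rV[R]_n := const_mx 1%R.
have ab i : (a 0 i <= b 0 i)%R by rewrite !mxE; lra.
rewrite surface_measureE /= /mscale/= lte_mul_pinfty//.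
rewrite /pushforward /mrestr.
set box : set (Rd R n) :=
  [set x : 'rV[R]_n | forall i, x 0%R i \in `]a 0%R i, b 0%R i]].
have mbox : measurable box by exact: measurable_box.
apply: (@le_lt_trans _ _ (lebesgue_rV n box)).
  apply: le_measure; rewrite ?inE//.
    apply: measurableI => //; rewrite -[X in measurable X]setTI.
    exact: measurable_direction.
  move=> x [_ /andP[_ x1]] i; rewrite !mxE in_itv/=.
  have xx : ((x : 'rV[R]_n) 0%R i ^+ 2 <= 1)%R.
    have d1 : (dot (x : 'rV[R]_n) x <= 1)%R.
      by move: x1; rewrite /enorm -[X in (_ <= X)%R]sqrtr1 ler_sqrt.
    apply: (le_trans _ d1).
    rewrite /dot (bigD1 i)//= -expr2 lerDl sumr_ge0// => j _.
    by rewrite -expr2 sqr_ge0.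
  by apply/andP; split; nra.
by rewrite lebesgue_rV_box// ltry.
Qed.

HB.instance Definition _ := Measure_isFinite.Build _ _ _ surface_measure
  surface_measure_finite.

End surface_measure.
End lebesgue.

(* Main.v *)
Require Import Defs.
From HB Require Import structures.
From mathcomp Require Import all_boot all_order all_algebra.
From mathcomp Require Import all_classical all_reals all_analysis.
From mathcomp Require Import complex measurable_realfun ring lra.
Import Order.TTheory GRing.Theory Num.Theory.
Import numFieldNormedType.Exports.

Set Implicit Arguments.
Unset Strict Implicit.
Unset Printing Implicit Defensive.

Local Open Scope classical_set_scope.
Local Open Scope ring_scope.

(** Let [mu] be a finite signed measure on the quadric [S], written as the
    difference of its Jordan parts [m1] and [m2], and let [B] be the symmetric
    bilinear form of [Q].

    If [Q u <> 0], a line parallel to [u] meets [S] in at most two points, which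
    the affine reflection [refl u] exchanges. If the Fourier transform of [mu]
    vanishes on the hyperplane orthogonal to [u], then the image of [mu] under
    the projection along [u] is zero ([fourier_subspace_inj]). A function
    invariant under the reflection coincides on [S] with one that factors
    through the projection, so that [mu] changes sign under the reflection
    ([diff_integral_refl]).

    Hence [mu] is odd under the reflections [s1] and [s2] in the directions
    [u1] and [u2], and invariant under [tau = s1 \o s2]. On the affine functions
    [p = B x u1 + dot v u1] and [q = B x u2 + dot v u2], the map [tau] acts by a
    matrix of determinant 1 and trace [4 c - 2], where
    [c = B u1 u2 ^+ 2 / (Q u1 * Q u2)]. The points with [p = 0] are fixed by
    [s1], so [mu] does not charge that set. Outside of it:
    - if [c < 0], [c = 1] or [1 < c], what is left is a union of finitely many
      sets, each exhausted by sets which all orbits of [tau] eventually leave,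
      and such sets are not charged, by invariance ([agree_on_eigen],
      [agree_on_shear]);
    - if [0 <= c < 1], the map [tau] is a rotation in a complex coordinate [z],
      and [s1] is the conjugation. When the rotation has infinite order,
      invariance under [tau] and oddness under [s1] make all the moments
      [h * z ^+ m * conjc z ^+ n] vanish, for [h] invariant, and these determine
      [mu] ([elliptic_eq]).

    What remains is the case where [0 <= c < 1] and the rotation has finite
    order: these pairs [(u1, u2)] are the exceptional ones. Only countably many
    values of [c] occur, and for each of them and each [u1] with [Q u1 <> 0] the
    condition on [u2] is a quadratic equation, which fails at [u2 = u1] because
    [c != 1]. Its solutions therefore form a null set, and the exceptional set
    is null by Fubini's theorem ([exceptional_pairs_negligible]).

    Both determination results rest on a functional monotone class argument
    ([multiplicative_class]): two finite measures with the same integrals on a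
    class of bounded functions, whose span is closed under products, agree on
    the sigma-algebra generated by the class. *)

(** * Integrals against a difference of two finite measures *)

(** Bounded measurable real functions. *)
Definition bounded_measurable (R : realType) d (T : measurableType d)
    (f : T -> R) : Prop :=
  measurable_fun setT f /\ exists M : R, forall x, `|f x| <= M.

Section bounded_measurable.
Context (R : realType) d (T : measurableType d).
Implicit Types f g : T -> R.

Lemma bounded_measurable_cst (r : R) : bounded_measurable (fun _ : T => r).
Proof. by split; [exact: measurable_cst|exists `|r|]. Qed.

Lemma bounded_measurableD f g : bounded_measurable f -> bounded_measurable g ->
  bounded_measurable (fun x => f x + g x).
Proof.
move=> [mf [M fM]] [mg [N gN]]; split; first exact: measurable_funD.
by exists (M + N) => x; rewrite (le_trans (ler_normD _ _))// lerD.
Qed.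

Lemma bounded_measurableM f g : bounded_measurable f -> bounded_measurable g ->
  bounded_measurable (fun x => f x * g x).
Proof.
move=> [mf [M fM]] [mg [N gN]]; split; first exact: measurable_funM.
by exists (M * N) => x; rewrite normrM ler_pM.
Qed.

Lemma bounded_measurableZ (r : R) f : bounded_measurable f ->
  bounded_measurable (fun x => r * f x).
Proof.
by move=> bf; apply: bounded_measurableM => //; exact: bounded_measurable_cst.
Qed.

Lemma bounded_measurable_indic (A : set T) : measurable A ->
  bounded_measurable (\1_A : T -> R).
Proof.
move=> mA; split; first exact: measurable_indic.
by exists 1 => x; rewrite indicE; case: (_ \in _); rewrite ?normr0 ?normr1.
Qed.

Lemma bounded_measurable_cvg (f_ : (T -> R)^nat) f (M : R) :
  (forall n, measurable_fun setT (f_ n)) -> (forall n x, `|f_ n x| <= M) ->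
  (forall x, f_ ^~ x @ \oo --> f x) -> bounded_measurable f.
Proof.
move=> mf fM ff; split; first exact: (@measurable_fun_cvg _ _ _ _ f_).
exists M => x; have /cvg_norm fx := ff x; apply: (cvgr_to_le fx).
by apply: nearW => n; exact: fM.
Qed.

End bounded_measurable.

Lemma bounded_measurable_comp (R : realType) d1 d2 (T1 : measurableType d1)
    (T2 : measurableType d2) (f : T2 -> R) (phi : T1 -> T2) :
  measurable_fun setT phi -> bounded_measurable f ->
  bounded_measurable (f \o phi).
Proof.
move=> mphi [mf [M fM]]; split; first exact: measurableT_comp.
by exists M => x; exact: fM.
Qed.

Section diff_integral.
Context (R : realType) d (T : measurableType d).
Variables (m1 m2 : {finite_measure set T -> \bar R}).
Implicit Types f g : T -> R.

(** The integral of [f] against the signed measure [m1 - m2]. *)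
Definition diff_integral f : R := \int[m1]_x f x - \int[m2]_x f x.

Lemma bounded_measurable_integrable (m : {finite_measure set T -> \bar R}) f :
  bounded_measurable f -> m.-integrable setT (EFin \o f).
Proof.
move=> [mf [M fM]]; apply: measurable_bounded_integrable => //.
  by rewrite ltey_eq fin_num_measure.
exists M; split; first exact: num_real.
by move=> y My x _; rewrite /= (le_trans (fM x))// ltW.
Qed.

Lemma diff_integralD f g : bounded_measurable f -> bounded_measurable g ->
  diff_integral (fun x => f x + g x) = diff_integral f + diff_integral g.
Proof.
move=> bf bg; rewrite /diff_integral !RintegralD//;
  try exact: bounded_measurable_integrable.
by ring.
Qed.

Lemma diff_integralZ r f : bounded_measurable f ->
  diff_integral (fun x => r * f x) = r * diff_integral f.
Proof.
move=> bf; rewrite /diff_integral !RintegralZl//;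
  try exact: bounded_measurable_integrable.
by ring.
Qed.

Lemma Rintegral_bounded_cvg (m : {finite_measure set T -> \bar R})
    (f_ : (T -> R)^nat) f (M : R) :
  (forall n, measurable_fun setT (f_ n)) -> (forall n x, `|f_ n x| <= M) ->
  (forall x, f_ ^~ x @ \oo --> f x) ->
  \int[m]_x f_ n x @[n --> \oo] --> \int[m]_x f x.
Proof.
move=> mf fM ff.
have mlim : measurable_fun setT f by exact: (@measurable_fun_cvg _ _ _ _ f_).
have [] := @dominated_convergence _ T R m setT measurableT
  (fun n => EFin \o f_ n) (EFin \o f) (cst M%:E).
- by move=> n; exact/measurable_EFinP.
- exact/measurable_EFinP.
- by apply: aeW => x _; apply/fine_cvgP; split; [exact: nearW|exact: ff].
- apply: (@bounded_measurable_integrable m (cst M)).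
  exact: bounded_measurable_cst.
- by apply: aeW => x n _; rewrite /= lee_fin.
move=> intf _; rewrite -[X in _ --> X](fineK (integrable_fin_num _ intf))//.
exact: fine_cvg.
Qed.

Lemma diff_integral_cvg (f_ : (T -> R)^nat) f (M : R) :
  (forall n, measurable_fun setT (f_ n)) -> (forall n x, `|f_ n x| <= M) ->
  (forall x, f_ ^~ x @ \oo --> f x) ->
  diff_integral (f_ n) @[n --> \oo] --> diff_integral f.
Proof.
by move=> mf fM ff; apply: cvgB; exact: (Rintegral_bounded_cvg mf fM ff).
Qed.

Lemma diff_integral_indic (A : set T) : measurable A ->
  diff_integral \1_A = fine (m1 A) - fine (m2 A).
Proof.
by move=> mA; rewrite /diff_integral /Rintegral !integral_indic// !setIT.
Qed.

Lemma diff_integral_indic_eq0 (A : set T) : measurable A ->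
  diff_integral \1_A = 0 <-> m1 A = m2 A.
Proof.
move=> mA; rewrite diff_integral_indic//; split => [/eqP|->]; last first.
  by rewrite subrr.
by rewrite subr_eq0 => /eqP h; rewrite -[LHS]fineK ?h ?fineK// fin_num_measure.
Qed.

End diff_integral.

(** * A functional monotone class theorem *)

(** The cubic [t |-> (3 t - t ^ 3) / 2] maps [[-1, 1]] into itself, and its
    iterates converge pointwise there to the sign function: it turns
    polynomial closure properties into closure under level sets. *)
Definition sign_step (R : realFieldType) (t : R) : R :=
  (3 / 2) * t + (- 1 / 2) * (t * (t * t)).

Lemma sign_step_itv (R : realFieldType) (t : R) :
  `|t| <= 1 -> `|sign_step t| <= 1.
Proof.
rewrite !ler_norml /sign_step => /andP[t1 t2]; apply/andP; split.
  have : 0 <= (1 + t) ^+ 2 * (2 - t) by rewrite mulr_ge0 ?sqr_ge0//; lra.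
  by rewrite expr2; lra.
have : 0 <= (1 - t) ^+ 2 * (2 + t) by rewrite mulr_ge0 ?sqr_ge0//; lra.
by rewrite expr2; lra.
Qed.

Lemma sign_stepN (R : realFieldType) (t : R) : sign_step (- t) = - sign_step t.
Proof. by rewrite /sign_step; ring. Qed.

Lemma sign_step_near1 (R : realFieldType) (t : R) n : 0 < t -> t <= 1 ->
  t <= iter n (@sign_step R) t <= 1 /\
  1 - iter n (@sign_step R) t <= (1 - t / 2) ^+ n.
Proof.
move=> t0 t1; elim: n => [|n [/andP[h1 h2] h3]].
  by rewrite /= expr0 lexx t1; split => //; lra.
rewrite iterS; set y := iter n _ t in h1 h2 h3 *.
have E : 1 - sign_step y = (1 - y) * ((1 - y) * (2 + y) / 2).
  by rewrite /sign_step; field.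
have F : (1 - y) * (2 + y) / 2 <= 1 - t / 2 by nra.
split.
  apply/andP; split; last first.
    by have := @sign_step_itv _ y; rewrite !ler_norml => /(_ _)/andP[]//; lra.
  have : 0 <= y * ((1 - y) * (1 + y)).
    by rewrite mulr_ge0 ?mulr_ge0//; lra.
  by rewrite /sign_step; lra.
rewrite E exprSr; apply: ler_pM => //; first lra.
by rewrite divr_ge0// mulr_ge0//; lra.
Qed.

Lemma cvg_sign_step (R : realType) (t : R) : `|t| <= 1 ->
  iter n (@sign_step R) t @[n --> \oo] --> Num.sg t.
Proof.
have pos (s : R) : 0 < s -> s <= 1 ->
    iter n (@sign_step R) s @[n --> \oo] --> (1 : R).
  move=> s0 s1.
  apply: (@squeeze_cvgr _ _ _ _ (fun n => 1 - (1 - s / 2) ^+ n) (cst 1)).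
  - apply: nearW => n /=; have [/andP[_ ->] h] := sign_step_near1 n s0 s1.
    by rewrite andbT; lra.
  - rewrite -[X in _ --> X]subr0; apply: cvgB; first exact: cvg_cst.
    by apply: cvg_expr; rewrite ger0_norm; lra.
  - exact: cvg_cst.
rewrite ler_norml => /andP[t1 t2].
have [t0|t0|->] := ltrgt0P t.
- by rewrite gtr0_sg//; exact: pos.
- rewrite ltr0_sg//.
  have E n : iter n (@sign_step R) t = - iter n (@sign_step R) (- t).
    elim: n => [|n IH]; first by rewrite /= opprK.
    by rewrite !iterS IH sign_stepN.
  under eq_fun do rewrite E.
  by apply: cvgN; apply: pos; lra.
- rewrite sgr0 (_ : (fun _ => _) = cst 0); first exact: cvg_cst.
  apply/funext => n /=; elim: n => // n IH.
  by rewrite iterS IH /sign_step; ring.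
Qed.

Section multiplicative_class.
Context (R : realType) d (T : measurableType d).
Variables (m1 m2 : {finite_measure set T -> \bar R}).
Variable M : (T -> R) -> Prop.
Hypothesis M_bounded : forall f, M f -> bounded_measurable f.
Hypothesis M1 : M (fun _ => 1).
Hypothesis M_mul : forall f g, M f -> M g -> exists c1 c2 f1 f2,
  [/\ M f1, M f2 & forall x, f x * g x = c1 * f1 x + c2 * f2 x].
Hypothesis M_eq : forall f, M f -> diff_integral m1 m2 f = 0.

Let I := diff_integral m1 m2.

Local Notation bmf := (@bounded_measurable R d T).
Let bmfM := @bounded_measurableM R d T.
Let bmfZ := @bounded_measurableZ R d T.
Let bmfD := @bounded_measurableD R d T.

(** The functions orthogonal to [M], and the multipliers of that space: the
    latter form an algebra, closed under bounded pointwise limits, which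
    contains [M]. *)
Let orth (h : T -> R) := bmf h /\ forall a, M a -> I (fun x => h x * a x) = 0.
Let mult (h : T -> R) := bmf h /\ forall g, orth g -> orth (fun x => h x * g x).

Let multM h k : mult h -> mult k -> mult (fun x => h x * k x).
Proof.
move=> [bh hh] [bk hk]; split; first exact: bmfM.
move=> g og; have := hh _ (hk _ og).
by congr orth; apply/funext => x; rewrite mulrA.
Qed.

Let mult_lin r s h k : mult h -> mult k -> mult (fun x => r * h x + s * k x).
Proof.
move=> [bh hh] [bk hk]; split; first by apply: bmfD; exact: bmfZ.
move=> g og; have [bhg hhg] := hh _ og; have [bkg hkg] := hk _ og.
have [bg _] := og.
split; first by apply: bmfM => //; apply: bmfD; exact: bmfZ.
move=> a Ma; have ba := M_bounded Ma.
rewrite /I (_ : (fun _ => _) =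
  fun x => r * (h x * g x * a x) + s * (k x * g x * a x)); last first.
  by apply/funext => x; ring.
have b1 := bmfM bhg ba; have b2 := bmfM bkg ba.
rewrite diff_integralD; [|exact: bmfZ..].
by rewrite !diff_integralZ// [X in r * X]hhg// [X in s * X]hkg// !mulr0 addr0.
Qed.

Let mult1 : mult (fun _ => 1).
Proof.
split; first exact: bounded_measurable_cst.
by move=> g; congr orth; apply/funext => x; rewrite mul1r.
Qed.

Let multZ r h : mult h -> mult (fun x => r * h x).
Proof.
move=> mh; have := mult_lin r 0 mh mult1.
by congr mult; apply/funext => x; ring.
Qed.

Let mult_cvg (h_ : (T -> R)^nat) h (B : R) : (forall n, mult (h_ n)) ->
  (forall n x, `|h_ n x| <= B) -> (forall x, h_ ^~ x @ \oo --> h x) -> mult h.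
Proof.
move=> mh hB hh.
have mfh n : measurable_fun setT (h_ n) by have [[]] := mh n.
have bh : bmf h := bounded_measurable_cvg mfh hB hh.
split => // g og; have [bg _] := og.
split; first exact: bmfM.
move=> a Ma; have ba := M_bounded Ma.
have [mga [N gaN]] := bmfM bg ba.
have cv : I (fun x => h_ n x * g x * a x) @[n --> \oo]
    --> I (fun x => h x * g x * a x).
  apply: (@diff_integral_cvg _ _ _ _ _ _ _ (B * N)).
  - move=> n; under eq_fun do rewrite -mulrA.
    exact: measurable_funM.
  - by move=> n x; rewrite -mulrA normrM ler_pM.
  - by move=> x; rewrite -!mulrA; under eq_fun do rewrite -mulrA; apply: cvgMl.
have z n : I (fun x => h_ n x * g x * a x) = 0.
  by have [_ /(_ _ og)[_ ->]] := mh n.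
move: cv; under eq_fun do rewrite z.
by move=> /(cvg_lim (@Rhausdorff R)) <-; rewrite lim_cst.
Qed.

Let M_mult f : M f -> mult f.
Proof.
move=> Mf; have bf := M_bounded Mf; split => // g [bg og].
split; first exact: bmfM.
move=> a Ma; have [c1 [c2 [f1 [f2 [M1f M2f fa]]]]] := M_mul Mf Ma.
rewrite /I (_ : (fun _ => _) =
  fun x => c1 * (g x * f1 x) + c2 * (g x * f2 x)); last first.
  by apply/funext => x; rewrite mulrAC fa; ring.
have b1 := bmfM bg (M_bounded M1f); have b2 := bmfM bg (M_bounded M2f).
rewrite diff_integralD; [|exact: bmfZ..].
by rewrite !diff_integralZ// [X in c1 * X]og// [X in c2 * X]og// !mulr0 addr0.
Qed.

Let mult_gt h (a : R) : mult h -> mult (\1_[set x | a < h x]).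
Proof.
move=> mh; have [[mfh [B hB]] _] := mh.
(* [k] is [h - a], rescaled so as to be bounded by 1. *)
pose C := `|B| + `|a| + 1.
have C0 : 0 < C by rewrite ltr_wpDl// addr_ge0.
pose k x := C^-1 * h x + (- a / C) * 1.
have kE x : k x = (h x - a) / C by rewrite /k; field; rewrite lt0r_neq0.
have mk : mult k by exact: mult_lin.
have k1 x : `|k x| <= 1.
  rewrite kE normrM (gtr0_norm (x := C^-1)) ?invr_gt0// ler_pdivrMr// mul1r.
  rewrite (le_trans (ler_normB _ _))// /C.
  by have := hB x; have := ler_norm B; lra.
have ms n : mult (fun x => iter n (@sign_step R) (k x)).
  elim: n => // n IH; under eq_fun do rewrite iterS /sign_step.
  by apply: mult_lin => //; apply: multM => //; exact: multM.
have ms1 : mult (fun x => Num.sg (k x)).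
  apply: (@mult_cvg _ _ 1 ms).
    by move=> n x; elim: n => //= n IH; exact: sign_step_itv.
  by move=> x; exact: cvg_sign_step.
(* The indicator of the positive numbers is [(sg + sg ^ 2) / 2]. *)
have := mult_lin (1 / 2) (1 / 2) ms1 (multM ms1 ms1).
congr mult; apply/funext => x.
rewrite indicE kE sgrM sgrV (gtr0_sg C0) mulr1.
have [xa|xa|xa] := ltrgtP a (h x).
- by rewrite mem_set//= gtr0_sg ?subr_gt0//; field.
- rewrite memNset /= ?ltr0_sg ?subr_lt0//; first by field.
  by apply/negP; rewrite -leNgt ltW.
- by rewrite memNset /= -?xa ?ltxx// subrr sgr0; field.
Qed.

Let mult_algebra : sigma_algebra setT [set A | measurable A /\ mult \1_A].
Proof.
have mC A : measurable A -> mult \1_A -> mult \1_(~` A).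
  move=> mA mu; have := mult_lin 1 (-1) mult1 mu.
  congr mult; apply/funext => x; rewrite !indicE in_setC.
  by case: (x \in A) => /=; ring.
have mI A B : mult \1_A -> mult \1_B -> mult \1_(A `&` B).
  move=> mA mB; have := multM mA mB.
  by congr mult; apply/funext => x; rewrite indicI.
have m0 : mult \1_(set0 : set T).
  have := multZ 0 mult1; congr mult; apply/funext => x.
  by rewrite indic0 mul0r.
split.
- by split => //; exact: measurable0.
- move=> A [mA muA]; rewrite setTD; split; first exact: measurableC.
  exact: mC.
- move=> A mA; split; first by apply: bigcupT_measurable => n; have [] := mA n.
  pose B n := \big[setU/set0]_(i < n) A i.
  have mB n : measurable (B n) /\ mult \1_(B n).
    elim: n => [|n [IH1 IH2]]; first by rewrite /B big_ord0; split.
    rewrite /B big_ord_recr/= -/(B n); have [h1 h2] := mA n.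
    split; first exact: measurableU.
    rewrite -[X in \1_X]setCK setCU; apply: (mC).
      by apply: measurableI; exact: measurableC.
    by apply: mI; apply: (mC).
  apply: (@mult_cvg (fun n => \1_(B n)) _ 1) => [n|n x|x].
  + by have [] := mB n.
  + by rewrite indicE; case: (_ \in _); rewrite ?normr0 ?normr1.
  + apply: cvg_near_cst; rewrite !indicE.
    have [/set_mem[k _ Akx]|/negP xnA] := boolP (x \in \bigcup_k A k).
      exists k.+1 => // n /= kn; rewrite indicE mem_set//.
      by move: Akx; exact: bigsetU_sup.
    apply: nearW => n; rewrite indicE memNset// => Bx; apply: xnA.
    by apply/mem_set; exact: bigsetU_bigcup Bx.
Qed.

(** Measures that agree on a multiplicative class agree on the sigma-algebra
    which it generates. *)
Theorem multiplicative_class (A : set T) :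
  <<s [set B | exists f a, M f /\ B = [set x | a < f x]] >> A -> m1 A = m2 A.
Proof.
move=> sA.
have [mA mu] : measurable A /\ mult \1_A.
  move: A sA; apply: smallest_sub; first exact: mult_algebra.
  move=> _ [f [a [Mf ->]]] /=; split; last exact/mult_gt/M_mult.
  have [mf _] := M_bounded Mf.
  rewrite (_ : [set x | _] = f @^-1` `]a, +oo[%classic).
    by rewrite -[X in measurable X]setTI; exact: mf.
  by apply/seteqP; split => x /=; rewrite in_itv/= andbT.
apply/diff_integral_indic_eq0 => //.
have o1 : orth (fun _ => 1).
  split; first exact: bounded_measurable_cst.
  by move=> a Ma; under eq_fun do rewrite mul1r; exact: M_eq.
have [_ /(_ _ o1)[_ /(_ _ M1)]] := mu.
by under eq_fun do rewrite !mulr1.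
Qed.

End multiplicative_class.

(** * Injectivity of the Fourier transform *)

Section generated_measurability.
Context (R : realType) d (T : measurableType d).
Variable M : (T -> R) -> Prop.

(** The sets [{a < f}], for [f] in the class [M]. *)
Definition level_sets : set (set T) :=
  [set B | exists f a, M f /\ B = [set x | a < f x]].

Lemma level_sets_measurable f : M f ->
  measurable_fun setT (f : g_sigma_algebraType level_sets -> R).
Proof.
move=> Mf; apply: (measurability _ (RGenOInfty.measurableE R)).
move=> _ [_ [a ->] <-]; rewrite setTI; apply: sub_sigma_algebra.
exists f, a; split => //; apply/seteqP.
by split => x /=; rewrite in_itv/= andbT.
Qed.

End generated_measurability.

(** Recovers a linear form from bounded trigonometric functions of it. *)
Lemma cvg_sin_scale (R : realType) (t : R) :
  n.+1%:R * sin (n.+1%:R^-1 * t) @[n --> \oo] --> t.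
Proof.
pose f (h : R) : R := sin (h * t).
have df : is_derive (0 : R) (1 : R) f t.
  have E : t = cos (0 * t) * t by rewrite mul0r cos0 mul1r.
  rewrite [X in is_derive _ _ _ X]E.
  have dl : is_derive (0 : R) (1 : R) (fun h : R => h * t) t.
    by apply: is_derive_eq; rewrite /GRing.scale /= mulr0 add0r mulr1.
  exact: is_derive1_comp (is_derive_sin _) dl.
have fd := @ex_derive _ _ _ _ _ _ _ df.
have : (fun h => h^-1 *: (f (h *: 1 + 0) - f 0)) x @[x --> 0^'] --> t.
  by rewrite -(@derive_val _ _ _ _ _ _ _ df); exact: fd.
move=> /cvg_dnbhs_at_right/cvg_at_rightP/(_ (fun n => n.+1%:R^-1)) h.
have n0 n : 0 < n.+1%:R^-1 :> R by rewrite invr_gt0.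
move: (h (conj n0 cvg_harmonic)); apply: cvg_trans.
apply: near_eq_cvg; apply: nearW => n /=.
by rewrite invrK /f mul0r sin0 subr0 addr0 /GRing.scale /= mulr1.
Qed.

Section trigonometric_class.
Context (R : realType) (n : nat).
Variables (m1 m2 : {finite_measure set (Rd R n) -> \bar R}).
Variable L : set 'rV[R]_n.
Hypothesis L0 : L 0.
Hypothesis LD : forall xi eta, L xi -> L eta -> L (xi + eta).
Hypothesis LZ : forall r xi, L xi -> L (r *: xi).
Hypothesis fourier_cos : forall xi, L xi ->
  diff_integral m1 m2 (fun x => cos (dot x xi)) = 0.
Hypothesis fourier_sin : forall xi, L xi ->
  diff_integral m1 m2 (fun x => sin (dot x xi)) = 0.

(** The real and imaginary parts of the characters with frequency in [L]. *)
Let trig (f : Rd R n -> R) := exists2 xi : 'rV[R]_n, L xi &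
  f = (fun x => cos (dot x xi)) \/ f = (fun x => sin (dot x xi)).

Lemma dotDr (x y z : 'rV[R]_n) : dot x (y + z) = dot x y + dot x z.
Proof.
by rewrite /dot -big_split; apply: eq_bigr => i _ /=; rewrite mxE mulrDr.
Qed.

Lemma dotZr (r : R) (x y : 'rV[R]_n) : dot x (r *: y) = r * dot x y.
Proof.
by rewrite /dot mulr_sumr; apply: eq_bigr => i _ /=; rewrite mxE mulrCA.
Qed.

Lemma measurable_dotr (y : 'rV[R]_n) :
  measurable_fun setT (fun x : Rd R n => dot (x : 'rV[R]_n) y).
Proof.
apply: measurable_sum => i.
by apply: measurable_funM; [exact: measurable_coord|exact: measurable_cst].
Qed.

Let trig_bounded f : trig f -> bounded_measurable f.
Proof.
move=> [xi _ [->|->]]; (split; last first).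
- by exists 1 => x; exact: cos_max.
- apply: (@measurableT_comp _ _ _ _ _ _ (@cos R)); last exact: measurable_dotr.
  by apply: continuous_measurable_fun; exact: continuous_cos.
- by exists 1 => x; exact: sin_max.
- apply: (@measurableT_comp _ _ _ _ _ _ (@sin R)); last exact: measurable_dotr.
  by apply: continuous_measurable_fun; exact: continuous_sin.
Qed.

Let trig1 : trig (fun _ => 1).
Proof.
exists 0 => //; left; apply/funext => x.
by rewrite -(scale0r (0 : 'rV_n)) dotZr mul0r cos0.
Qed.

Let trig_mul f g : trig f -> trig g -> exists c1 c2 f1 f2,
  [/\ trig f1, trig f2 & forall x, f x * g x = c1 * f1 x + c2 * f2 x].
Proof.
move=> [xi Lxi hf] [eta Leta hg].
have LB : L (xi + (-1) *: eta) by apply: LD => //; exact: LZ.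
have LD' := LD Lxi Leta.
have cD (x : 'rV[R]_n) : cos (dot x (xi + eta)) =
    cos (dot x xi) * cos (dot x eta) - sin (dot x xi) * sin (dot x eta).
  by rewrite dotDr cosD.
have cB (x : 'rV[R]_n) : cos (dot x (xi + (-1) *: eta)) =
    cos (dot x xi) * cos (dot x eta) + sin (dot x xi) * sin (dot x eta).
  by rewrite dotDr dotZr mulN1r cosB.
have sD (x : 'rV[R]_n) : sin (dot x (xi + eta)) =
    sin (dot x xi) * cos (dot x eta) + cos (dot x xi) * sin (dot x eta).
  by rewrite dotDr sinD.
have sB (x : 'rV[R]_n) : sin (dot x (xi + (-1) *: eta)) =
    sin (dot x xi) * cos (dot x eta) - cos (dot x xi) * sin (dot x eta).
  by rewrite dotDr dotZr mulN1r sinB.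
pose c z : Rd R n -> R := fun x => cos (dot x z).
pose s z : Rd R n -> R := fun x => sin (dot x z).
have tc z : L z -> trig (c z) by move=> Lz; exists z => //; left.
have ts z : L z -> trig (s z) by move=> Lz; exists z => //; right.
case: hf => ->; case: hg => ->.
- exists (1 / 2), (1 / 2), (c (xi + eta)), (c (xi + (-1) *: eta)).
  by split; [exact: tc|exact: tc|move=> x; rewrite /c cD cB; field].
- exists (1 / 2), (- 1 / 2), (s (xi + eta)), (s (xi + (-1) *: eta)).
  by split; [exact: ts|exact: ts|move=> x; rewrite /s sD sB; field].
- exists (1 / 2), (1 / 2), (s (xi + eta)), (s (xi + (-1) *: eta)).
  by split; [exact: ts|exact: ts|move=> x; rewrite /s sD sB; field].
- exists (- 1 / 2), (1 / 2), (c (xi + eta)), (c (xi + (-1) *: eta)).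
  by split; [exact: tc|exact: tc|move=> x; rewrite /c cD cB; field].
Qed.

(** If the Fourier transforms of [m1] and [m2] agree on a subspace [L], then
    so do their images under any map whose coordinates are linear forms
    [dot _ xi] with [xi] in [L]. *)
Theorem fourier_subspace_inj k (phi : Rd R n -> Rd R k) :
  (forall i, exists2 xi, L xi &
     forall x : 'rV[R]_n, (phi x : 'rV[R]_k) 0 i = dot x xi) ->
  forall B, measurable B -> m1 (phi @^-1` B) = m2 (phi @^-1` B).
Proof.
move=> hphi B mB.
apply: (multiplicative_class trig_bounded trig1 trig_mul).
  by move=> f [xi Lxi [->|->]]; [exact: fourier_cos|exact: fourier_sin].
have mphi : measurable_fun setT
    (phi : g_sigma_algebraType (level_sets trig) -> Rd R k).
  apply: measurable_rV => i; have [xi Lxi phiE] := hphi i.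
  under eq_fun do rewrite phiE.
  apply: (@measurable_fun_cvg _ (g_sigma_algebraType (level_sets trig)) R setT
    (fun m x => m.+1%:R * sin (dot (x : 'rV[R]_n) (m.+1%:R^-1 *: xi))))
    => [m|x _].
    apply: measurable_funM; first exact: measurable_cst.
    apply: level_sets_measurable; exists (m.+1%:R^-1 *: xi); last by right.
    exact: LZ.
  under eq_fun do rewrite dotZr.
  exact: cvg_sin_scale.
by rewrite -[X in <<s _ >> X]setTI; exact: mphi.
Qed.

End trigonometric_class.

(** * Reflections of a quadric *)

Section diff_integral_change.
Context (R : realType) d1 d2 (T1 : measurableType d1) (T2 : measurableType d2).
Variables (m1 m2 : {finite_measure set T1 -> \bar R}).

Lemma eq_diff_integral_ae (N : set T1) (f g : T1 -> R) :
  measurable N -> m1 N = 0%E -> m2 N = 0%E ->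
  measurable_fun setT f -> measurable_fun setT g ->
  (forall x, ~ N x -> f x = g x) ->
  diff_integral m1 m2 f = diff_integral m1 m2 g.
Proof.
move=> mN N1 N2 mf mg fg; rewrite /diff_integral /Rintegral.
by congr (fine _ - fine _); apply: ae_eq_integral => //;
  try exact/measurable_EFinP; exists N; split => // x /= nfg;
  apply: contrapT => /fg fgx; apply: nfg => _; rewrite fgx.
Qed.

Lemma diff_integral_comp_eq0 (phi : T1 -> T2) (f : T2 -> R) :
  measurable_fun setT phi ->
  (forall A, measurable A -> m1 (phi @^-1` A) = m2 (phi @^-1` A)) ->
  bounded_measurable f -> diff_integral m1 m2 (f \o phi) = 0.
Proof.
move=> mphi hphi bf; have [mf _] := bf.
pose P (m : {finite_measure set T1 -> \bar R}) : {measure set T2 -> \bar R} :=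
  @measure_function_pushforward__canonical__measure_function_Measure
    _ _ _ _ _ m _ mphi.
have E (m : {finite_measure set T1 -> \bar R}) :
    (\int[m]_x (f (phi x))%:E = \int[P m]_y (f y)%:E)%E.
  rewrite (@integral_pushforward _ _ _ _ _ _ mphi m setT (EFin \o f))//.
    exact/measurable_EFinP.
  apply: (@bounded_measurable_integrable _ _ _ m (f \o phi)).
  exact: bounded_measurable_comp.
rewrite /diff_integral /Rintegral /= !E.
rewrite (@eq_measure_integral _ _ _ _ (P m2) (P m1)) ?subrr//.
by move=> A mA _; exact: hphi.
Qed.

End diff_integral_change.

Section quadric_reflection.
Context (R : realType) (d : nat) (B : {symmetric 'rV[R]_d}).
Variables (v : 'rV[R]_d) (rho : R).
Implicit Types x y u w : 'rV[R]_d.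

Lemma formDl x y w : B (x + y) w = B x w + B y w.
Proof. exact: (linearDl B w x y). Qed.

Lemma formZl r x w : B (r *: x) w = r * B x w.
Proof. exact: (linearZl_LR B w r x). Qed.

Lemma formC x y : B x y = B y x.
Proof. by have := hermC B x y; rewrite expr0 mul1r. Qed.

Lemma formDr x y w : B x (y + w) = B x y + B x w.
Proof. by rewrite !(formC x) formDl. Qed.

Lemma formZr r x w : B x (r *: w) = r * B x w.
Proof. by rewrite !(formC x) formZl. Qed.

Lemma dotC x y : dot x y = dot y x.
Proof. by apply: eq_bigr => i _; rewrite mulrC. Qed.

Lemma dot_sphere u : sphere u -> dot u u = 1.
Proof.
move=> u1; have : enorm u ^+ 2 = 1 by rewrite u1 expr1n.
by rewrite /enorm sqr_sqrtr// sumr_ge0// => i _; rewrite -expr2 sqr_ge0.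
Qed.

(** The inhomogeneous quadratic polynomial whose level sets are the quadrics,
    and half of its derivative in the direction [u]. *)
Definition qpoly x : R := B x x + 2 * dot v x.
Definition half_deriv u x : R := B x u + dot v u.

(** The affine reflection in the direction [u], which exchanges the two
    intersection points of a line parallel to [u] with each level set of
    [qpoly]. *)
Definition refl u x : 'rV[R]_d := x - (2 * half_deriv u x / B u u) *: u.

Lemma qpoly_line u x t :
  qpoly (x + t *: u) = qpoly x + 2 * t * half_deriv u x + t ^+ 2 * B u u.
Proof.
rewrite /qpoly /half_deriv dotDr dotZr !formDr !formDl !formZr !formZl.
by rewrite (formC u x); ring.
Qed.

Lemma half_deriv_line u w x t :
  half_deriv w (x + t *: u) = half_deriv w x + t * B u w.
Proof. by rewrite /half_deriv formDl formZl; ring. Qed.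

Lemma reflE u x : refl u x = x + (- (2 * half_deriv u x / B u u)) *: u.
Proof. by rewrite /refl scaleNr. Qed.

Lemma half_deriv_refl u w x : half_deriv w (refl u x) =
  half_deriv w x - 2 * half_deriv u x / B u u * B u w.
Proof. by rewrite reflE half_deriv_line mulNr. Qed.

Lemma half_deriv_reflN u x : B u u != 0 ->
  half_deriv u (refl u x) = - half_deriv u x.
Proof. by move=> a0; rewrite half_deriv_refl; field. Qed.

Lemma reflK u : B u u != 0 -> involutive (refl u).
Proof.
move=> a0 x; rewrite {1}/refl half_deriv_reflN// /refl -addrA -opprD -scalerDl.
by rewrite -mulrDl mulrN subrr mul0r scale0r subr0.
Qed.

Lemma measurable_formr u : measurable_fun setT (fun x : Rd R d => B x u).
Proof.
rewrite (_ : (fun _ => _) =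
    fun x : Rd R d => \sum_(i < d) x 0 i * B (delta_mx 0 i) u); last first.
  apply/funext => x; rewrite {1}[x]row_sum_delta.
  have add0 : B 0 u = 0 by rewrite -(scale0r 0) formZl mul0r.
  rewrite (big_morph (B ^~ u) (fun x y => formDl x y u) add0).
  by apply: eq_bigr => i _; rewrite formZl.
apply: measurable_sum => i.
by apply: measurable_funM; [exact: measurable_coord|exact: measurable_cst].
Qed.

Lemma measurable_form : measurable_fun setT (fun x : Rd R d => B x x).
Proof.
rewrite (_ : (fun _ => _) =
    fun x : Rd R d => \sum_(i < d) x 0 i * B x (delta_mx 0 i)); last first.
  apply/funext => x; rewrite {2}[x]row_sum_delta.
  have add0 : B x 0 = 0 by rewrite -(scale0r 0) formZr mul0r.
  rewrite (big_morph (B x) (formDr x) add0).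
  by apply: eq_bigr => i _; rewrite formZr.
apply: measurable_sum => i.
by apply: measurable_funM; [exact: measurable_coord|exact: measurable_formr].
Qed.

Lemma measurable_dotl u : measurable_fun setT (fun x : Rd R d => dot u x).
Proof. under eq_fun do rewrite dotC; exact: measurable_dotr. Qed.

Lemma measurable_qpoly : measurable_fun setT (qpoly : Rd R d -> R).
Proof.
apply: measurable_funD; first exact: measurable_form.
apply: measurable_funM; first exact: measurable_cst.
exact: measurable_dotl.
Qed.

Lemma measurable_half_deriv u :
  measurable_fun setT (half_deriv u : Rd R d -> R).
Proof.
apply: measurable_funD; first exact: measurable_formr.
exact: measurable_cst.
Qed.

Lemma measurable_line u (t : Rd R d -> R) : measurable_fun setT t ->
  measurable_fun setT (fun x : Rd R d => (x : 'rV[R]_d) + t x *: u : Rd R d).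
Proof.
move=> mt; apply: measurable_rV => i; under eq_fun do rewrite !mxE.
apply: measurable_funD; first exact: measurable_coord.
by apply: measurable_funM => //; exact: measurable_cst.
Qed.

Lemma measurable_refl u : measurable_fun setT (refl u : Rd R d -> Rd R d).
Proof.
rewrite (_ : refl u =
  fun x : 'rV[R]_d => x + (- (2 / B u u) * half_deriv u x) *: u); last first.
  by apply/funext => x; rewrite reflE; congr (_ + _ *: _); ring.
apply: measurable_line; apply: measurable_funM; first exact: measurable_cst.
exact: measurable_half_deriv.
Qed.

Lemma measurable_quadric :
  measurable ([set x | qpoly x = rho] : set (Rd R d)).
Proof.
rewrite (_ : [set _ | _] = qpoly @^-1` [set rho])//.
by rewrite -[X in measurable X]setTI; exact: measurable_qpoly.
Qed.

(** The orthogonal projection along [u], for a unit vector [u], and a Borel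
    section of it: one of the points of the quadric on a given line parallel to
    [u], provided that there is one. *)
Definition proj u x : 'rV[R]_d := x + (- dot x u) *: u.
Definition qsection u y : 'rV[R]_d :=
  y + (- (half_deriv u y / B u u) +
    Num.sqrt ((half_deriv u y / B u u) ^+ 2 - (qpoly y - rho) / B u u)) *: u.

Lemma measurable_proj u : measurable_fun setT (proj u : Rd R d -> Rd R d).
Proof.
apply: measurable_line; apply: measurableT_comp; last exact: measurable_dotr.
exact: oppr_measurable.
Qed.

Lemma measurable_qsection u :
  measurable_fun setT (qsection u : Rd R d -> Rd R d).
Proof.
have ml : measurable_fun setT (fun y : Rd R d => half_deriv u y / B u u).
  apply: measurable_funM; last exact: measurable_cst.
  exact: measurable_half_deriv.
apply: measurable_line; apply: measurable_funD.
  by apply: measurableT_comp => //; exact: oppr_measurable.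
apply: (@measurableT_comp _ _ _ _ _ _ (@Num.sqrt R)).
  by apply: continuous_measurable_fun; exact: sqrt_continuous.
apply: measurable_funB.
  by under eq_fun do rewrite expr2; exact: measurable_funM.
apply: measurable_funM; last exact: measurable_cst.
by apply: measurable_funB; [exact: measurable_qpoly|exact: measurable_cst].
Qed.

Lemma qsection_proj u x : B u u != 0 -> qpoly x = rho ->
  qsection u (proj u x) = x \/ qsection u (proj u x) = refl u x.
Proof.
move=> a0 xS; rewrite /qsection /proj half_deriv_line qpoly_line xS.
set a := B u u in a0 *; set l := half_deriv u x; set t := dot x u.
rewrite (_ : _ ^+ 2 - _ = (l / a) ^+ 2); last by field.
rewrite sqrtr_sqr -addrA -scalerDl.
have [la|la] := leP 0 (l / a).
- left; rewrite (ger0_norm la) (_ : - t + _ = 0) ?scale0r ?addr0//.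
  by field.
- right; rewrite reflE -/a -/l (ltr0_norm la); congr (_ + _ *: _).
  by field.
Qed.

Variables (m1 m2 : {finite_measure set (Rd R d) -> \bar R}).
Hypothesis S1 : m1 (~` [set x | qpoly x = rho]) = 0%E.
Hypothesis S2 : m2 (~` [set x | qpoly x = rho]) = 0%E.

(** A signed measure on the quadric whose Fourier transform vanishes on the
    hyperplane orthogonal to [u] changes sign under the reflection in the
    direction [u]: its image under the projection along [u] vanishes, and
    functions invariant under the reflection factor through the projection. *)
Theorem diff_integral_refl u : sphere u -> B u u != 0 ->
  (forall xi, hyperplane u xi ->
     diff_integral m1 m2 (fun x => cos (dot x xi)) = 0) ->
  (forall xi, hyperplane u xi ->
     diff_integral m1 m2 (fun x => sin (dot x xi)) = 0) ->
  forall f : Rd R d -> R, bounded_measurable f ->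
  diff_integral m1 m2 (f \o refl u) = - diff_integral m1 m2 f.
Proof.
move=> u1 a0 hcos hsin f bf.
have du := dot_sphere u1.
have projE (A : set (Rd R d)) : measurable A ->
    m1 (proj u @^-1` A) = m2 (proj u @^-1` A).
  move=> mA; apply: (@fourier_subspace_inj _ _ _ _ (hyperplane u)) mA => //.
  - by rewrite /hyperplane /= dotC -(scale0r 0) dotZr mul0r.
  - move=> x y; rewrite /hyperplane /= !(dotC _ u) dotDr => -> ->.
    by rewrite addr0.
  - move=> r x; rewrite /hyperplane /= !(dotC _ u) dotZr => ->.
    by rewrite mulr0.
  - (* The [i]-th coordinate of the projection is the linear form associated
       with the projection of the [i]-th basis vector. *)
    move=> i; exists (delta_mx 0 i + (- u 0 i) *: u).
      rewrite /hyperplane /= dotC dotDr dotZr du /dot (bigD1 i)//= big1.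
        by rewrite !mxE !eqxx /=; ring.
      by move=> j /negPf ji; rewrite !mxE ji andbF mulr0.
    move=> x; rewrite /proj !mxE dotDr dotZr {2}/dot (bigD1 i)//= big1.
      by rewrite !mxE !eqxx /=; ring.
    by move=> j /negPf ji; rewrite !mxE ji andbF mulr0.
have mS := measurable_quadric.
have bR : bounded_measurable (f \o refl u : Rd R d -> R).
  by apply: bounded_measurable_comp bf; exact: measurable_refl.
(* [f + f \o refl u] is invariant under the reflection, so that, on the quadric,
   it is unchanged by the composition with the section of the projection. *)
pose g (x : Rd R d) : R := f x + f (refl u x).
have bg : bounded_measurable g by exact: bounded_measurableD.
have mr : measurable_fun setT (qsection u \o proj u : Rd R d -> Rd R d).
  exact: (measurableT_comp (measurable_qsection u) (measurable_proj u)).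
have g0 : diff_integral m1 m2 (g \o (qsection u \o proj u)) = 0.
  apply: diff_integral_comp_eq0 => // A mA.
  rewrite comp_preimage; apply: projE.
  by rewrite -[X in measurable X]setTI; exact: measurable_qsection.
apply/eqP; rewrite -addr_eq0 addrC -diff_integralD//; apply/eqP.
rewrite -g0.
apply: (@eq_diff_integral_ae _ _ _ _ _ _ _ _ (measurableC mS)) => //.
- by have [] := bg.
- by have [mg _] := bg; exact: measurableT_comp.
- move=> x /contrapT /= xS; rewrite /g /=.
  by have [->|->] := qsection_proj a0 xS => //; rewrite reflK// addrC.
Qed.

End quadric_reflection.

(** * Dynamics of a product of two involutions *)

Section involutions.
Context (R : realType) d (T : measurableType d).
Variables (m1 m2 : {finite_measure set T -> \bar R}).
Variables s1 s2 : T -> T.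
Hypothesis ms1 : measurable_fun setT s1.
Hypothesis ms2 : measurable_fun setT s2.
Let I := diff_integral m1 m2.
Hypothesis anti1 : forall f : T -> R, bounded_measurable f ->
  I (f \o s1) = - I f.
Hypothesis anti2 : forall f : T -> R, bounded_measurable f ->
  I (f \o s2) = - I f.

Let tau := s1 \o s2.

Let mtau : measurable_fun setT tau.
Proof. exact: measurableT_comp. Qed.

Let diff_integral_tau (f : T -> R) : bounded_measurable f -> I (f \o tau) = I f.
Proof.
move=> bf; rewrite (_ : f \o tau = (f \o s1) \o s2)//.
by rewrite anti2 ?anti1 ?opprK//; exact: bounded_measurable_comp.
Qed.

Let diff_integral_iter (f : T -> R) n : bounded_measurable f ->
  bounded_measurable (f \o iter n tau) /\ I (f \o iter n tau) = I f.
Proof.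
elim: n f => [//|n IH] f bf.
have bft : bounded_measurable (f \o tau) by exact: bounded_measurable_comp.
have [h1 h2] := IH _ bft; split; first exact: h1.
exact: etrans h2 (diff_integral_tau bf).
Qed.

(** The measures agree on all the measurable subsets of [A]. *)
Definition agree_on (A : set T) :=
  forall C, measurable C -> C `<=` A -> m1 C = m2 C.

Lemma agree_onU (A D : set T) : measurable A -> agree_on A -> agree_on D ->
  agree_on (A `|` D).
Proof.
move=> mA hA hD C mC CAD.
have mCA : measurable (C `&` A) by exact: measurableI.
have mCD : measurable (C `\` A) by exact: measurableD.
rewrite -(setUIDK C A) !measureU//;
  try by apply/seteqP; split => x // -[[_ ?] []].
congr (_ + _)%E; first by apply: hA => // x [].
by apply: hD => // x [Cx nAx]; case: (CAD _ Cx).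
Qed.

Lemma agree_on_bigcup (A : (set T)^nat) : (forall k, measurable (A k)) ->
  (forall k l, (k <= l)%N -> A k `<=` A l) ->
  (forall k, agree_on (A k)) -> agree_on (\bigcup_k A k).
Proof.
move=> mA ndA hA C mC CA; apply/diff_integral_indic_eq0 => //.
have mCA k : measurable (C `&` A k) by exact: measurableI.
have : diff_integral m1 m2 \1_(C `&` A n) @[n --> \oo] -->
    diff_integral m1 m2 \1_C.
  apply: (@diff_integral_cvg _ _ _ _ _ (fun n => \1_(C `&` A n)) _ 1).
  - by move=> n; exact: measurable_indic.
  - by move=> n x; rewrite indicE; case: (_ \in _); rewrite ?normr0 ?normr1.
  - move=> x; apply: cvg_near_cst; rewrite !indicE.
    have [/set_mem Cx|/negP nCx] := boolP (x \in C).
      have [k _ Akx] := CA _ Cx; exists k => // n /= kn.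
      by rewrite indicE mem_set//; split => //; exact: ndA Akx.
    apply: nearW => n; rewrite indicE memNset// => -[Cx _].
    by apply: nCx; exact: mem_set.
have z n : diff_integral m1 m2 \1_(C `&` A n) = 0.
  by apply/diff_integral_indic_eq0 => //; apply: hA => // x [].
under eq_fun do rewrite z.
by move=> /(cvg_lim (@Rhausdorff R)) <-; rewrite lim_cst.
Qed.

Lemma agree_on_fixed (A : set T) : (forall x, A x -> s1 x = x) ->
  (forall x, A (s1 x) -> A x) -> agree_on A.
Proof.
move=> fixA invA C mC CA; apply/diff_integral_indic_eq0 => //.
have := anti1 (bounded_measurable_indic R mC).
rewrite (_ : \1_C \o s1 = \1_C); first by rewrite /I; lra.
apply/funext => x /=; rewrite !indicE; congr ((nat_of_bool _)%:R).
apply/idP/idP => /set_mem Cx; apply/mem_set; last by rewrite fixA//; exact: CA.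
by move: (Cx); rewrite fixA//; apply: invA; exact: CA.
Qed.

(** Recurrence: a set that all the orbits of [s1 \o s2] eventually leave is
    not charged. *)
Lemma agree_on_wandering (A : set T) :
  (forall x, \forall n \near \oo, ~ A (iter n tau x)) -> agree_on A.
Proof.
move=> wA C mC CA; apply/diff_integral_indic_eq0 => //.
have bC := bounded_measurable_indic R mC.
have : I (\1_C \o iter n tau) @[n --> \oo] --> I (cst 0).
  apply: (@diff_integral_cvg _ _ _ _ _ (fun n => \1_C \o iter n tau) _ 1).
  - by move=> n; have [[]] := diff_integral_iter n bC.
  - by move=> n x; rewrite /= indicE; case: (_ \in _); rewrite ?normr0 ?normr1.
  - move=> x; apply: cvg_near_cst; near=> n => /=.
    rewrite indicE memNset// => /CA; near: n; exact: wA.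
under eq_fun do rewrite (diff_integral_iter _ bC).2.
move=> /(cvg_lim (@Rhausdorff R)); rewrite lim_cst// -/I => ->.
by rewrite /I /diff_integral !Rintegral_cst// !mul0r subrr.
Unshelve. all: by end_near. Qed.

(** Hyperbolic behaviour: an eigenfunction of [s1 \o s2] for an eigenvalue of
    modulus different from 1. *)
Lemma agree_on_eigen (phi : T -> R) (kappa : R) : measurable_fun setT phi ->
  (forall x, phi (s1 (s2 x)) = kappa * phi x) -> `|kappa| != 1 ->
  agree_on [set x | phi x != 0].
Proof.
move=> mphi phitau k1.
have iterE n x : phi (iter n tau x) = kappa ^+ n * phi x.
  by elim: n => [|n IH]; rewrite ?expr0 ?mul1r// iterS phitau IH exprS mulrA.
pose A (k : nat) := [set x : T | k.+1%:R^-1 <= `|phi x| <= k.+1%:R].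
have -> : [set x | phi x != 0] = \bigcup_k A k.
  apply/seteqP; split => x /=; last first.
    move=> [k _ /andP[+ _]]; rewrite -normr_gt0; apply: lt_le_trans.
    by rewrite invr_gt0.
  move=> px; pose a := Num.max `|phi x| `|phi x|^-1.
  exists (Num.trunc a) => //.
  have := ltW (truncnS_gt a); rewrite {1}/a ge_max => /andP[h1 h2].
  by rewrite /A /= h1 andbT invf_ple// posrE ?normr_gt0.
apply: agree_on_bigcup => [k|k l kl x /andP[h1 h2]|k].
- rewrite (_ : A k = (Num.norm \o phi) @^-1` `[k.+1%:R^-1, k.+1%:R]%classic).
    rewrite -[X in measurable X]setTI.
    by apply: (measurableT_comp (@normr_measurable R setT) mphi).
  by apply/seteqP; split => x /=; rewrite in_itv.
- apply/andP; split; last by rewrite (le_trans h2)// ler_nat.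
  by rewrite (le_trans _ h1)// lef_pV2 ?posrE// ler_nat.
apply: agree_on_wandering => x.
have [px|px] := eqVneq (phi x) 0.
  apply: nearW => n.
  by rewrite /A /= iterE px mulr0 normr0 leNgt invr_gt0 ltr0n.
have px0 : 0 < `|phi x| by rewrite normr_gt0.
have [k_lt1|k_gt1|/eqP] := ltgtP `|kappa| 1; last by rewrite (negbTE k1).
- have e0 : 0 < k.+1%:R^-1 / `|phi x| by rewrite divr_gt0// invr_gt0.
  have := @cvg_expr R `|kappa|; rewrite normr_id => /(_ k_lt1) h.
  have [N _ hN] := @cvgr0_norm_lt _ _ _ _ _ _ h _ e0.
  exists N => // n /hN /=.
  rewrite ger0_norm ?exprn_ge0// ltr_pdivlMr// => hn /andP[+ _].
  by rewrite iterE normrM normrX leNgt hn.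
- have e0 : 0 < `|phi x| / k.+1%:R by rewrite divr_gt0.
  have kp : 0 < `|kappa| by rewrite (lt_trans ltr01).
  have := @cvg_expr R `|kappa|^-1; rewrite normfV normr_id.
  rewrite invf_lt1// => /(_ k_gt1) h.
  have [N _ hN] := @cvgr0_norm_lt _ _ _ _ _ _ h _ e0.
  exists N => // n /hN /=.
  rewrite ger0_norm ?exprn_ge0 ?invr_ge0// ltr_pdivlMr// exprVn.
  rewrite ltr_pdivrMl ?exprn_gt0// => hn /andP[_].
  by rewrite iterE normrM normrX leNgt hn.
Qed.

(** Parabolic behaviour: [s1 \o s2] shears [phi] by the invariant function
    [psi], on an invariant set. *)
Lemma agree_on_shear (D : set T) (phi psi : T -> R) :
  measurable D -> measurable_fun setT phi -> measurable_fun setT psi ->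
  (forall x, D (s1 (s2 x)) <-> D x) ->
  (forall x, D x -> phi (s1 (s2 x)) = phi x + psi x) ->
  (forall x, D x -> psi (s1 (s2 x)) = psi x) ->
  agree_on (D `&` [set x | psi x != 0]).
Proof.
move=> mD mphi mpsi Dtau phitau psitau.
have DE n x : D (iter n tau x) <-> D x.
  by elim: n => // n IH; rewrite iterS; apply: iff_trans (Dtau _) IH.
have psiE n x : D x -> psi (iter n tau x) = psi x.
  move=> Dx; elim: n => // n IH; rewrite iterS psitau//.
  exact: (DE n x).2 Dx.
have phiE n x : D x -> phi (iter n tau x) = phi x + psi x *+ n.
  move=> Dx; elim: n => [|n IH]; first by rewrite mulr0n addr0.
  have Dn := (DE n x).2 Dx.
  by rewrite iterS phitau// psiE// IH mulrSr addrA.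
pose A (k : nat) :=
  D `&` [set x | psi x != 0] `&` [set x : T | `|phi x| <= k%:R].
have -> : D `&` [set x | psi x != 0] = \bigcup_k A k.
  apply/seteqP; split => x; last by move=> [k _ []].
  move=> h; exists (Num.trunc `|phi x|).+1 => //; split => //=.
  exact/ltW/truncnS_gt.
apply: agree_on_bigcup => [k|k l kl x [h1 h2]|k].
- apply: measurableI; first apply: measurableI => //.
    rewrite (_ : [set _ | _] = psi @^-1` (~` [set 0])); last first.
      by apply/seteqP; split => x /= /eqP.
    by rewrite -[X in measurable X]setTI; apply: mpsi => //; exact: measurableC.
  rewrite (_ : [set _ | _] = phi @^-1` `[- k%:R, k%:R]%classic).
    by rewrite -[X in measurable X]setTI; apply: mphi.
  by apply/seteqP; split => x /=; rewrite in_itv/= -ler_norml.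
- by split => //=; rewrite (le_trans h2)// ler_nat.
apply: agree_on_wandering => x.
have [Dx|nDx] := pselect (D x); last first.
  by apply: nearW => n [[/DE]].
have [px|px] := eqVneq (psi x) 0.
  by apply: nearW => n [[_ /=]]; rewrite psiE// px eqxx.
have px0 : 0 < `|psi x| by rewrite normr_gt0.
pose N := (Num.trunc ((k%:R + `|phi x|) / `|psi x|)).+1.
exists N => // n /= Nn [_ /=]; rewrite phiE//; apply/negP; rewrite -ltNge.
have : (k%:R + `|phi x|) / `|psi x| < n%:R.
  by apply: lt_le_trans (truncnS_gt _) _; rewrite ler_nat.
rewrite ltr_pdivrMr// mulr_natl => h.
have := ler_normB (phi x + psi x *+ n) (phi x).
by rewrite addrC addKr normrMn; lra.
Qed.

End involutions.

Section elliptic.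
Context (R : realType) d (T : measurableType d).
Variables (m1 m2 : {finite_measure set T -> \bar R}).
Variables s1 s2 : T -> T.
Let I := diff_integral m1 m2.
Hypothesis anti1 : forall f : T -> R, bounded_measurable f ->
  I (f \o s1) = - I f.
Hypothesis anti2 : forall f : T -> R, bounded_measurable f ->
  I (f \o s2) = - I f.
Hypothesis ms1 : measurable_fun setT s1.

Variables (z : T -> R[i]) (lam : R[i]).
Hypothesis mRe : measurable_fun setT (fun x => complex.Re (z x)).
Hypothesis mIm : measurable_fun setT (fun x => complex.Im (z x)).
Hypothesis z_s1 : forall x, z (s1 x) = conjc (z x).
Hypothesis z_tau : forall x, z (s1 (s2 x)) = lam * z x.
Hypothesis lam_unit : lam * conjc lam = 1.
Hypothesis lam_aperiodic : forall k, (0 < k)%N -> lam ^+ k != 1.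

(** The moments, and below the real functions that they give rise to. *)
Let mon (m n : nat) x : R[i] := z x ^+ m * conjc (z x) ^+ n.

Let ReM (a b : R[i]) :
  complex.Re (a * b) =
  complex.Re a * complex.Re b - complex.Im a * complex.Im b.
Proof. by case: a b => [a1 a2] [b1 b2]. Qed.

Let ImM (a b : R[i]) :
  complex.Im (a * b) =
  complex.Re a * complex.Im b + complex.Im a * complex.Re b.
Proof. by case: a b => [a1 a2] [b1 b2]. Qed.

Let ReJ (a : R[i]) : complex.Re (conjc a) = complex.Re a.
Proof. by case: a. Qed.

Let ImJ (a : R[i]) : complex.Im (conjc a) = - complex.Im a.
Proof. by case: a. Qed.

Let monM m n k l x : mon m n x * mon k l x = mon (m + k) (n + l) x.
Proof. by rewrite /mon !exprD; ring. Qed.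

Let monJ m n x : conjc (mon m n x) = mon n m x.
Proof. by rewrite /mon rmorphM !rmorphXn /= conjcK mulrC. Qed.

Let mon_s1 m n x : mon m n (s1 x) = conjc (mon m n x).
Proof. by rewrite monJ /mon z_s1 conjcK mulrC. Qed.

Let mon_tau m n x : mon m n (s1 (s2 x)) = lam ^+ m * conjc lam ^+ n * mon m n x.
Proof. by rewrite /mon z_tau rmorphM !exprMn; ring. Qed.

Let mon_diag m x : complex.Im (mon m m x) = 0.
Proof. by have := ImJ (mon m m x); rewrite monJ; lra. Qed.

Let eigen_neq1 m n : m != n -> lam ^+ m * conjc lam ^+ n != 1.
Proof.
wlog mn : m n / (n < m)%N.
  move=> H mn; have [|nm] := ltnP n m; first by move=> h; exact: H.
  have nm' : (m < n)%N by rewrite ltn_neqAle mn.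
  have := H _ _ nm' _; rewrite eq_sym => /(_ mn).
  apply: contra_neq => /(congr1 conjc).
  by rewrite conjc1 rmorphM !rmorphXn /= conjcK mulrC.
move=> _; rewrite -(subnK (ltnW mn)) exprD -mulrA -exprMn lam_unit expr1n mulr1.
by apply: lam_aperiodic; rewrite subn_gt0.
Qed.

(** Functions invariant under both involutions. *)
Definition biinvariant (h : T -> R) := [/\ measurable_fun setT h,
  forall x, h (s1 x) = h x & forall x, h (s1 (s2 x)) = h x].

Let re h m n x := h x * complex.Re (mon m n x).
Let im h m n x := h x * complex.Im (mon m n x).

Let class (f : T -> R) := exists h m n,
  [/\ biinvariant h, bounded_measurable (re h m n),
      bounded_measurable (im h m n) & f = re h m n \/ f = im h m n].

Let class_bounded f : class f -> bounded_measurable f.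
Proof. by move=> [h [m [n [_ ? ? [->|->]]]]]. Qed.

Let class1 : class (fun _ => 1).
Proof.
have E0 x : mon 0 0 x = 1 by rewrite /mon !expr0 mul1r.
exists (fun _ => 1), 0, 0; split.
- by split => //; exact: measurable_cst.
- rewrite /re; under eq_fun do rewrite E0 mul1r.
  exact: bounded_measurable_cst.
- rewrite /im; under eq_fun do rewrite E0 mul1r.
  exact: bounded_measurable_cst.
- by left; apply/funext => x; rewrite /re E0 mul1r.
Qed.

Let class_mul f g : class f -> class g -> exists c1 c2 f1 f2,
  [/\ class f1, class f2 & forall x, f x * g x = c1 * f1 x + c2 * f2 x].
Proof.
move=> [h [m [n [[mh h1 h2] bre bim hf]]]].
move=> [k [p [q [[mk k1 k2] bre' bim' hg]]]].
pose hk x := h x * k x.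
have ihk : biinvariant hk.
  split; first exact: measurable_funM.
  - by move=> x; rewrite /hk h1 k1.
  - by move=> x; rewrite /hk h2 k2.
have r1 x : re hk (m + p) (n + q) x =
    re h m n x * re k p q x + (-1) * (im h m n x * im k p q x).
  by rewrite /re /im /hk -monM ReM; ring.
have i1 x : im hk (m + p) (n + q) x =
    re h m n x * im k p q x + im h m n x * re k p q x.
  by rewrite /re /im /hk -monM ImM; ring.
have r2 x : re hk (m + q) (n + p) x =
    re h m n x * re k p q x + im h m n x * im k p q x.
  by rewrite /re /im /hk -monM -(monJ p q) ReM ReJ ImJ; ring.
have i2 x : im hk (m + q) (n + p) x =
    im h m n x * re k p q x + (-1) * (re h m n x * im k p q x).
  by rewrite /re /im /hk -monM -(monJ p q) ImM ReJ ImJ; ring.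
have bM := @bounded_measurableM R d T; have bD := @bounded_measurableD R d T.
have bZ := @bounded_measurableZ R d T.
have br1 : bounded_measurable (re hk (m + p) (n + q)).
  by rewrite (funext r1); apply: (bD); [exact: bM|exact/bZ/bM].
have bi1 : bounded_measurable (im hk (m + p) (n + q)).
  by rewrite (funext i1); apply: (bD); exact: bM.
have br2 : bounded_measurable (re hk (m + q) (n + p)).
  by rewrite (funext r2); apply: (bD); exact: bM.
have bi2 : bounded_measurable (im hk (m + q) (n + p)).
  by rewrite (funext i2); apply: (bD); [exact: bM|exact/bZ/bM].
have cr1 : class (re hk (m + p) (n + q)).
  by exists hk, (m + p)%N, (n + q)%N; split; auto.
have ci1 : class (im hk (m + p) (n + q)).
  by exists hk, (m + p)%N, (n + q)%N; split; auto.
have cr2 : class (re hk (m + q) (n + p)).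
  by exists hk, (m + q)%N, (n + p)%N; split; auto.
have ci2 : class (im hk (m + q) (n + p)).
  by exists hk, (m + q)%N, (n + p)%N; split; auto.
case: hf hg => -> [] ->.
- exists (1 / 2), (1 / 2); do 2 eexists; split; [exact: cr1|exact: cr2|].
  by move=> x; rewrite r1 r2; field.
- exists (1 / 2), (- 1 / 2); do 2 eexists; split; [exact: ci1|exact: ci2|].
  by move=> x; rewrite i1 i2; field.
- exists (1 / 2), (1 / 2); do 2 eexists; split; [exact: ci1|exact: ci2|].
  by move=> x; rewrite i1 i2; field.
- exists (- 1 / 2), (1 / 2); do 2 eexists; split; [exact: cr1|exact: cr2|].
  by move=> x; rewrite r1 r2; field.
Qed.

Let class_eq f : class f -> I f = 0.
Proof.
move=> [h [m [n [[mh h1 h2] bre bim hf]]]].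
(* Real parts are invariant under [s1], for which [I] is odd; imaginary parts
   are then multiplied by the eigenvalue [mu] of [s1 \o s2]. *)
have a0 : I (re h m n) = 0.
  have := anti1 bre; rewrite (_ : re h m n \o s1 = re h m n); first by lra.
  by apply/funext => x; rewrite /re /= h1 mon_s1 ReJ.
case: hf => -> //.
have [<-|mn] := eqVneq m n.
  rewrite (_ : im h m m = fun x => 0 * 1); last first.
    by apply/funext => x; rewrite /im mon_diag mulr0 mul0r.
  by rewrite /I diff_integralZ ?mul0r//; exact: bounded_measurable_cst.
set mu := lam ^+ m * conjc lam ^+ n.
have inv g : bounded_measurable g -> I (g \o (s1 \o s2)) = I g.
  move=> bg; rewrite (_ : g \o _ = (g \o s1) \o s2)//.
  by rewrite anti2 ?anti1 ?opprK//; exact: bounded_measurable_comp.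
have bZ := @bounded_measurableZ R d T.
have ea : complex.Im mu * I (im h m n) = 0.
  have := inv _ bre.
  rewrite (_ : _ \o _ = fun x => complex.Re mu * re h m n x +
      (- complex.Im mu) * im h m n x); last first.
    by apply/funext => x /=; rewrite /re /im h2 mon_tau -/mu ReM; ring.
  rewrite /I diff_integralD; [|exact: bZ..].
  by rewrite !diff_integralZ// -/I a0; lra.
have eb : complex.Re mu * I (im h m n) = I (im h m n).
  have := inv _ bim.
  rewrite (_ : _ \o _ = fun x => complex.Re mu * im h m n x +
      complex.Im mu * re h m n x); last first.
    by apply/funext => x /=; rewrite /re /im h2 mon_tau -/mu ImM; ring.
  rewrite /I diff_integralD; [|exact: bZ..].
  by rewrite !diff_integralZ// -/I a0; lra.
apply/eqP; apply: contraTT (eigen_neq1 mn) => b0; rewrite negbK -/mu.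
move: ea eb => /eqP; rewrite mulf_eq0 (negbTE b0) orbF => /eqP mu0 eb.
rewrite eq_complex /= mu0 eqxx andbT; apply/eqP.
by apply: (mulIf b0); rewrite eb mul1r.
Qed.

(** Elliptic behaviour: if [s1 \o s2] acts as a rotation of infinite order on
    [z], and [s1] as a reflection, then the moments
    [h * z ^+ m * conjc z ^+ n], for [h] invariant, all vanish, so the
    measures agree on the sigma-algebra generated by [z] and the invariant
    functions. *)
Theorem elliptic_eq k (phi : T -> Rd R k) :
  (forall i, exists w a b, biinvariant w /\ forall x,
     (phi x : 'rV[R]_k) 0 i =
       w x + a * complex.Re (z x) + b * complex.Im (z x)) ->
  forall B, measurable B -> m1 (phi @^-1` B) = m2 (phi @^-1` B).
Proof.
move=> hphi B mB.
apply: (multiplicative_class class_bounded class1 class_mul class_eq).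
pose T' := g_sigma_algebraType (level_sets class).
have minv w : biinvariant w -> measurable_fun setT (w : T' -> R).
  move=> [mw w1 w2]; apply: (measurability _ (RGenOInfty.measurableE R)).
  move=> _ [_ [a ->] <-]; rewrite setTI; apply: sub_sigma_algebra.
  pose A := [set x | a < w x].
  have mA : measurable A.
    rewrite (_ : A = w @^-1` `]a, +oo[%classic).
      by rewrite -[X in measurable X]setTI; exact: mw.
    by apply/seteqP; split => x; rewrite /A /= in_itv/= andbT.
  exists \1_A, (1 / 2); split; last first.
    apply/seteqP; split => x; rewrite /= in_itv/= andbT => h.
      by rewrite indicE mem_set//=; lra.
    apply: contrapT => nh; move: h; rewrite indicE memNset//=.
    by lra.
  have E0 x : mon 0 0 x = 1 by rewrite /mon !expr0 mul1r.
  exists \1_A, 0, 0; split.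
  - split; first exact: measurable_indic.
    + by move=> x; rewrite !indicE /A; congr ((nat_of_bool _)%:R);
        apply/idP/idP => /set_mem h; apply/mem_set; move: h; rewrite /= w1.
    + by move=> x; rewrite !indicE /A; congr ((nat_of_bool _)%:R);
        apply/idP/idP => /set_mem h; apply/mem_set; move: h; rewrite /= w2.
  - rewrite /re; under eq_fun do rewrite E0 mulr1.
    exact: bounded_measurable_indic.
  - rewrite /im; under eq_fun do rewrite E0 mulr0.
    exact: bounded_measurable_cst.
  - by left; apply/funext => x; rewrite /re E0 mulr1.
have mz : measurable_fun setT ((fun x => complex.Re (z x)) : T' -> R) /\
    measurable_fun setT ((fun x => complex.Im (z x)) : T' -> R).
  pose r x := complex.Re (z x) ^+ 2 + complex.Im (z x) ^+ 2.
  have E1 x : mon 1 0 x = z x by rewrite /mon expr1 expr0 mulr1.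
  have mr : measurable_fun setT r.
    by apply: measurable_funD; under eq_fun do rewrite expr2;
      exact: measurable_funM.
  have rJ x : r (s1 x) = r x by rewrite /r z_s1 ReJ ImJ sqrrN.
  have rtau x : r (s1 (s2 x)) = r x.
    have rE y : r y = complex.Re (z y * conjc (z y)).
      by rewrite /r ReM ReJ ImJ; ring.
    rewrite !rE z_tau rmorphM /=; congr complex.Re.
    by rewrite mulrACA lam_unit mul1r.
  (* [z] need not be bounded: it is a limit of its truncations to the invariant
     sets where its modulus is bounded. *)
  pose A (K : nat) := [set x | r x <= K%:R].
  have mA K : measurable (A K).
    rewrite (_ : A K = r @^-1` `]-oo, K%:R]%classic).
      by rewrite -[X in measurable X]setTI; exact: mr.
    by apply/seteqP; split => x; rewrite /A /= in_itv.
  have iA K : biinvariant \1_(A K).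
    split; first exact: measurable_indic.
    + by move=> x; rewrite !indicE /A; congr ((nat_of_bool _)%:R);
        apply/idP/idP => /set_mem h; apply/mem_set; move: h; rewrite /= rJ.
    + by move=> x; rewrite !indicE /A; congr ((nat_of_bool _)%:R);
        apply/idP/idP => /set_mem h; apply/mem_set; move: h; rewrite /= rtau.
  have bnd (f : T -> R) K : measurable_fun setT f ->
      (forall x, f x ^+ 2 <= r x) ->
      bounded_measurable (fun x => \1_(A K) x * f x).
    move=> mf fr; split.
      by apply: measurable_funM => //; exact: measurable_indic.
    exists K.+1%:R => x; rewrite indicE.
    have [/set_mem Ax|_] := boolP (x \in A K); last by rewrite mul0r normr0.
    rewrite mul1r; have := le_trans (fr x) Ax; rewrite -real_normK ?num_real//.
    have := normr_ge0 (f x); set y := `|f x|; rewrite -natr1.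
    have : 0 <= K%:R :> R by []. nra.
  have cv (f : T -> R) x : \1_(A K) x * f x @[K --> \oo] --> f x.
    apply: cvg_near_cst; exists (Num.trunc (r x)).+1 => // K /= hK.
    rewrite indicE mem_set ?mul1r//= /A /=.
    by rewrite (le_trans (ltW (truncnS_gt _)))// ler_nat.
  have bre K : bounded_measurable (re \1_(A K) 1 0).
    rewrite /re; under eq_fun do rewrite E1; apply: bnd => // x.
    by rewrite /r lerDl sqr_ge0.
  have bim K : bounded_measurable (im \1_(A K) 1 0).
    rewrite /im; under eq_fun do rewrite E1; apply: bnd => // x.
    by rewrite /r lerDr sqr_ge0.
  split.
    apply: (@measurable_fun_cvg _ T' R setT
      (fun K => re \1_(A K) 1 0)) => [K|x _].
      by apply: level_sets_measurable; exists \1_(A K), 1%N, 0%N; split; auto.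
    rewrite /re; under eq_fun do rewrite E1.
    exact: (cv (fun x => complex.Re (z x))).
  apply: (@measurable_fun_cvg _ T' R setT
    (fun K => im \1_(A K) 1 0)) => [K|x _].
    by apply: level_sets_measurable; exists \1_(A K), 1%N, 0%N; split; auto.
  rewrite /im; under eq_fun do rewrite E1.
  exact: (cv (fun x => complex.Im (z x))).
have mphi : measurable_fun setT (phi : T' -> Rd R k).
  apply: measurable_rV => i; have [w [a [b [iw phiE]]]] := hphi i.
  under eq_fun do rewrite phiE.
  have [mz1 mz2] := mz.
  apply: measurable_funD; first apply: measurable_funD.
  - exact: minv.
  - by apply: measurable_funM => //; exact: measurable_cst.
  - by apply: measurable_funM => //; exact: measurable_cst.
by rewrite -[X in <<s _ >> X]setTI; exact: mphi.
Qed.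

End elliptic.

(** * Signed measures odd under two reflections *)

(** For [0 <= c <= 1], the unit complex number [exp (2 i t)], where [t] is the
    angle between [0] and [pi / 2] with [cos t ^+ 2 = c]. *)
Definition double_angle (R : realType) (c : R) : R[i] :=
  ((2 * c - 1) +i* (2 * Num.sqrt (c * (1 - c))))%C.

Section two_reflections.
Context (R : realType) (d : nat) (B : {symmetric 'rV[R]_d}).
Variables (v u1 u2 : 'rV[R]_d).
Hypothesis a0 : B u1 u1 != 0.
Hypothesis b0 : B u2 u2 != 0.
Hypothesis indep : forall r, u1 <> r *: u2.
Variables (m1 m2 : {finite_measure set (Rd R d) -> \bar R}).
Let s1 : Rd R d -> Rd R d := refl B v u1.
Let s2 : Rd R d -> Rd R d := refl B v u2.
Hypothesis anti1 : forall f : Rd R d -> R, bounded_measurable f ->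
  diff_integral m1 m2 (f \o s1) = - diff_integral m1 m2 f.
Hypothesis anti2 : forall f : Rd R d -> R, bounded_measurable f ->
  diff_integral m1 m2 (f \o s2) = - diff_integral m1 m2 f.

Let a := B u1 u1.
Let b := B u2 u2.
Let g := B u1 u2.
(** The product of the two reflections acts on the plane coordinates [p], [q]
    by a matrix of determinant 1 and trace [4 * c - 2]. *)
Let c := g ^+ 2 / (a * b).
Let p : Rd R d -> R := half_deriv B v u1.
Let q : Rd R d -> R := half_deriv B v u2.

Let ms1 : measurable_fun setT s1. Proof. exact: measurable_refl. Qed.
Let ms2 : measurable_fun setT s2. Proof. exact: measurable_refl. Qed.
Let mp : measurable_fun setT p. Proof. exact: measurable_half_deriv. Qed.
Let mq : measurable_fun setT q. Proof. exact: measurable_half_deriv. Qed.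

Let p_s1 x : p (s1 x) = - p x. Proof. exact: half_deriv_reflN. Qed.
Let q_s2 x : q (s2 x) = - q x. Proof. exact: half_deriv_reflN. Qed.
Let q_s1 x : q (s1 x) = q x - 2 * g / a * p x.
Proof. by rewrite /q half_deriv_refl -/a -/g -/(p x); field. Qed.
Let p_s2 x : p (s2 x) = p x - 2 * g / b * q x.
Proof. by rewrite /p half_deriv_refl formC -/b -/g -/(q x); field. Qed.

Let p_tau x : p (s1 (s2 x)) = - p x + 2 * g / b * q x.
Proof. by rewrite p_s1 p_s2; ring. Qed.
Let q_tau x : q (s1 (s2 x)) = - (2 * g / a) * p x + (4 * c - 1) * q x.
Proof. by rewrite q_s1 p_s2 q_s2 /c; field; rewrite a0 b0. Qed.

Let measurable_comb r s : measurable_fun setT (fun x => r * p x + s * q x).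
Proof.
by apply: measurable_funD; apply: measurable_funM => //; exact: measurable_cst.
Qed.

Let measurable_eq0 (f : Rd R d -> R) : measurable_fun setT f ->
  measurable [set x | f x = 0].
Proof.
move=> mf; rewrite (_ : [set _ | _] = f @^-1` [set 0])//.
by rewrite -[X in measurable X]setTI; exact: mf.
Qed.

Let measurable_neq0 (f : Rd R d -> R) : measurable_fun setT f ->
  measurable [set x | f x != 0].
Proof.
move=> mf; rewrite (_ : [set _ | _] = ~` [set x | f x = 0]).
  by apply: measurableC; exact: measurable_eq0.
by apply/seteqP; split => x /= /eqP.
Qed.

Let agree_p0 : agree_on m1 m2 [set x | p x = 0].
Proof.
apply: (agree_on_fixed anti1) => x /=; last by rewrite p_s1; lra.
by rewrite /s1 /refl -/(p x) => ->; rewrite mulr0 mul0r scale0r subr0.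
Qed.

Let hyperbolic : 0 < c * (c - 1) -> agree_on m1 m2 setT.
Proof.
move=> hc; set s := Num.sqrt (c * (c - 1)).
have s0 : 0 < s by rewrite sqrtr_gt0.
have ss : s ^+ 2 = c * (c - 1) by rewrite sqr_sqrtr// ltW.
have g0 : g != 0.
  by apply: contraTneq hc => g0; rewrite /c g0 expr0n/= !mul0r ltxx.
have cE : g ^+ 2 = c * (a * b) by rewrite /c; field; rewrite a0 b0.
(* The eigenfunction for a root [k] of the characteristic polynomial. *)
pose e k x := 2 * g * p x + - (a * (k + 1)) * q x.
have eigen k : k ^+ 2 + (2 - 4 * c) * k + 1 = 0 ->
    agree_on m1 m2 [set x | e k x != 0].
  move=> kE; apply: (agree_on_eigen ms1 ms2 anti1 anti2 _ (kappa := k)).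
  - exact: measurable_comb.
  - move=> x; rewrite /e p_tau q_tau.
    have -> : 2 * g * (- p x + 2 * g / b * q x) =
        - (2 * g * p x) + 4 * (g ^+ 2 / b) * q x by field.
    have -> : g ^+ 2 / b = c * a by rewrite cE; field.
    have -> : - (a * (k + 1)) * (- (2 * g / a) * p x + (4 * c - 1) * q x) =
        2 * g * (k + 1) * p x - a * ((k + 1) * (4 * c - 1)) * q x.
      by field.
    apply/eqP; rewrite -subr_eq0; apply/eqP.
    transitivity (a * q x * (k ^+ 2 + (2 - 4 * c) * k + 1)); first by ring.
    by rewrite kE mulr0.
  - apply/negP => /eqP k1.
    have k2 : k ^+ 2 = 1 by rewrite -real_normK ?num_real// k1 expr1n.
    have /eqP : (k - 1) * (k + 1) = 0 by rewrite -subr_sqr k2; ring.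
    rewrite mulf_eq0 => /orP[] /eqP h.
      have kk : k = 1 by lra.
      move: kE hc; rewrite kk expr1n => h1.
      by rewrite (_ : c = 1) ?subrr ?mulr0 ?ltxx//; lra.
    have kk : k = - 1 by lra.
    move: kE hc; rewrite kk sqrrN expr1n => h1.
    by rewrite (_ : c = 0) ?mul0r ?ltxx//; lra.
have kE r : r ^+ 2 = c * (c - 1) ->
    (2 * c - 1 + 2 * r) ^+ 2 + (2 - 4 * c) * (2 * c - 1 + 2 * r) + 1 = 0.
  move=> hr; rewrite (_ : _ + 1 = 4 * r ^+ 2 - 4 * (c * (c - 1))); last by ring.
  by rewrite hr subrr.
have -> : setT = [set x | e (2 * c - 1 + 2 * s) x != 0] `|`
    ([set x | e (2 * c - 1 + 2 * - s) x != 0] `|` [set x | p x = 0]).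
  apply/seteqP; split => // x _ /=.
  have [e1|] := eqVneq (e (2 * c - 1 + 2 * s) x) 0; last by left.
  have [e2|] := eqVneq (e (2 * c - 1 + 2 * - s) x) 0; last by right; left.
  right; right; apply/eqP; move: e1 e2; rewrite /e => e1 e2.
  have /eqP : a * s * q x = 0.
    apply: (@mulfI _ 4) => //; rewrite mulr0.
    by rewrite -(subrr 0) -{1}e2 -e1; ring.
  rewrite !mulf_eq0 (negbTE a0) (gt_eqF s0) /= => /eqP q0.
  by move/eqP: e1; rewrite q0 mulr0 addr0 !mulf_eq0 (negbTE g0) orbF pnatr_eq0.
apply: agree_onU; [by apply: measurable_neq0; exact: measurable_comb| |].
  by apply: eigen; exact: kE.
apply: agree_onU; last exact: agree_p0.
  by apply: measurable_neq0; exact: measurable_comb.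
by apply: eigen; apply: kE; rewrite sqrrN.
Qed.

Let parabolic : c = 1 -> agree_on m1 m2 setT.
Proof.
move=> c1.
have gE : g ^+ 2 = a * b.
  have -> : g ^+ 2 = c * (a * b) by rewrite /c; field; rewrite a0 b0.
  by rewrite c1 mul1r.
have g0 : g != 0.
  by rewrite -sqrf_eq0 gE mulf_neq0.
have gg : g / a * (g / b) = 1.
  by rewrite mulrACA -expr2 gE -invfM divff// mulf_neq0.
(* The product of the reflections preserves [e] and shears [p] by a multiple of
   it. Where [e] vanishes, it preserves [p] and translates by a multiple of
   [p x *: w]. *)
pose e x := - (g / a) * p x + 1 * q x.
have me : measurable_fun setT e by exact: measurable_comb.
have e_tau x : e (s1 (s2 x)) = e x.
  rewrite /e p_tau q_tau c1.
  transitivity (g / a * p x + (3 - 2 * (g / a * (g / b))) * q x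
    - 2 * (g / a) * p x); first by ring.
  by rewrite gg; ring.
pose w : 'rV[R]_d := u1 + (- (g / b)) *: u2.
have w0 : dot w w != 0.
  apply/negP => /eqP ww; apply: (indep (r := g / b)).
  suff /eqP : w = 0.
    by rewrite /w addr_eq0 scaleNr opprK => /eqP.
  apply/rowP => i; rewrite [RHS]mxE; apply/eqP.
  rewrite -sqrf_eq0 eq_le sqr_ge0 andbT.
  rewrite -ww /dot (bigD1 i)//= -expr2 lerDl.
  by apply: sumr_ge0 => j _; rewrite -expr2 sqr_ge0.
pose psi1 x := 2 * g / b * e x.
pose psi2 x := 2 / a * dot w w * p x.
have -> : setT = setT `&` [set x | psi1 x != 0] `|`
    ([set x | e x = 0] `&` [set x | psi2 x != 0] `|` [set x | p x = 0]).
  apply/seteqP; split => // x _ /=.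
  have [e1|e1] := eqVneq (e x) 0; last first.
    by left; split => //; rewrite !mulf_neq0// invr_neq0.
  right; have [p1|p1] := eqVneq (p x) 0; first by right.
  by left; split => //; rewrite !mulf_neq0// invr_neq0.
have m_psi1 : measurable_fun setT psi1.
  by apply: measurable_funM => //; exact: measurable_cst.
have m_psi2 : measurable_fun setT psi2.
  by apply: measurable_funM => //; exact: measurable_cst.
apply: agree_onU.
- by apply: measurableI => //; exact: measurable_neq0.
- apply: (agree_on_shear ms1 ms2 anti1 anti2 (phi := p)) => //.
  + move=> x _; rewrite p_tau /psi1 /e.
    transitivity (p x + (2 * g / b * q x - 2 * (g / a * (g / b)) * p x));
      last by ring.
    by rewrite gg; ring.
  + by move=> x _; rewrite /psi1 e_tau.
apply: agree_onU; last exact: agree_p0.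
  by apply: measurableI; [exact: measurable_eq0|exact: measurable_neq0].
have qE x : e x = 0 -> q x = g / a * p x by rewrite /e; lra.
apply: (agree_on_shear ms1 ms2 anti1 anti2
  (phi := fun x : Rd R d => dot (x : 'rV[R]_d) w)) => //.
- exact: measurable_eq0.
- exact: measurable_dotr.
- by move=> x /=; rewrite e_tau.
- move=> x /= ex; have qx := qE _ ex.
  rewrite /s1 reflE -/a -/(p (s2 x)) p_s2 /s2 reflE -/b -/(q x) qx.
  rewrite !(dotC _ w) !dotDr !dotZr /psi2.
  have -> : dot w w = dot w u1 + - (g / b) * dot w u2 by rewrite dotDr dotZr.
  have -> : 2 * g / b * (g / a * p x) = 2 * p x.
    transitivity (2 * (g / a * (g / b)) * p x); first by ring.
    by rewrite gg mulr1.
  by field; rewrite a0 b0.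
- move=> x /= ex; rewrite /psi2 p_tau (qE _ ex); congr (_ * _).
  transitivity (- p x + 2 * (g / a * (g / b)) * p x); first by ring.
  by rewrite gg; ring.
Qed.

Let elliptic : 0 <= c < 1 ->
  (forall k, (0 < k)%N -> double_angle c ^+ k != 1) ->
  agree_on m1 m2 setT.
Proof.
move=> /andP[c_ge0 c_lt1] aper.
(* For [c = 0], the product of the reflections has order 2. *)
have c0 : c != 0.
  apply/negP => /eqP cz; have := aper 2%N isT; rewrite /double_angle cz.
  rewrite !mul0r sqrtr0 !mulr0 sub0r expr2 eq_complex /=.
  by rewrite !(mulr0, mul0r, subr0, addr0) mulrNN mulr1 !eqxx.
have c_gt0 : 0 < c by rewrite lt_def c0.
have g0 : g != 0.
  by apply: contra_neq c0 => g0; rewrite /c g0 expr0n/= mul0r.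
have cE : g ^+ 2 = c * (a * b) by rewrite /c; field; rewrite a0 b0.
set r := Num.sqrt (c * (1 - c)).
have r_gt0 : 0 < r by rewrite sqrtr_gt0 mulr_gt0// subr_gt0.
have r0 : r != 0 by rewrite gt_eqF.
have rr : r ^+ 2 = c * (1 - c) by rewrite sqr_sqrtr// mulr_ge0// subr_ge0 ltW.
pose Y x := c / r * p x + - (g / b / r) * q x.
pose z x : R[i] := (Y x +i* (- p x))%C.
have D0 : a * b - g ^+ 2 != 0.
  rewrite cE (_ : _ - _ = (1 - c) * (a * b)); last by ring.
  by rewrite !mulf_neq0// subr_eq0 gt_eqF.
have qE x : q x = b / g * (c * p x - r * Y x).
  by rewrite /Y; field; rewrite r0 b0 g0.
have Y_s1 x : Y (s1 x) = Y x.
  rewrite /Y p_s1 q_s1.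
  transitivity (- (c / r) * p x + 2 * (g ^+ 2 / (a * b)) / r * p x
     - g / b / r * q x); first by rewrite invfM; ring.
  by rewrite -/c; ring.
have p_tau' x : p (s1 (s2 x)) = (2 * c - 1) * p x - 2 * r * Y x.
  by rewrite p_tau (qE x); field; rewrite b0 g0.
have Y_tau x : Y (s1 (s2 x)) = 2 * r * p x + (2 * c - 1) * Y x.
  rewrite {1}/Y p_tau q_tau.
  transitivity (- (c / r) * p x + 2 * (g ^+ 2 / (a * b)) / r * p x
     + (c / r * 2 - (4 * c - 1) / r) * (g / b * q x)).
    by rewrite invfM; ring.
  rewrite -/c; have -> : g / b * q x = c * p x - r * Y x.
    by rewrite (qE x); field; rewrite b0 g0.
  apply: (mulfI r0).
  transitivity (2 * (c * (1 - c)) * p x + (2 * c - 1) * (r * Y x)).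
    by field.
  by rewrite -rr; ring.
move=> A mA _.
apply: (@elliptic_eq _ _ _ m1 m2 s1 s2 anti1 anti2 ms1 z (double_angle c)
   _ _ _ _ _ aper d id _ A mA).
- exact: measurable_comb.
- by apply: measurableT_comp mp; exact: oppr_measurable.
- by move=> x; rewrite /z /= Y_s1 p_s1.
- move=> x; rewrite /z /double_angle -/r Y_tau p_tau'; apply/eqP.
  by rewrite eq_complex /=; apply/andP; split; apply/eqP; ring.
- rewrite /double_angle -/r; apply/eqP; rewrite eq_complex /=.
  apply/andP; split; apply/eqP; last by ring.
  transitivity ((2 * c - 1) ^+ 2 + 4 * r ^+ 2); first by ring.
  by rewrite rr; ring.
- (* [w] is the component that is orthogonal to the plane of [u1] and [u2] for
     the form [B], on which the reflections act trivially. *)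
  move=> i.
  pose al := (b * u1 0 i - g * u2 0 i) / (a * b - g ^+ 2).
  pose be := (a * u2 0 i - g * u1 0 i) / (a * b - g ^+ 2).
  have al1 : al * a + be * g = u1 0 i by rewrite /al /be; field.
  have be1 : al * g + be * b = u2 0 i by rewrite /al /be; field.
  pose w (x : Rd R d) : R := (x : 'rV[R]_d) 0 i - (al * p x + be * q x).
  have w_s1 x : w (s1 x) = w x.
    rewrite /w p_s1 q_s1 /s1 /refl -/a -/(p x) !mxE -al1.
    by field.
  have w_s2 x : w (s2 x) = w x.
    rewrite /w p_s2 q_s2 /s2 /refl -/b -/(q x) !mxE -be1.
    by field.
  exists w, (- (be * (b / g) * r)), (- (al + be * (b / g) * c)).
  split; first split => //.
  + apply: measurable_funB; first exact: measurable_coord.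
    exact: measurable_comb.
  + by move=> x; rewrite w_s1 w_s2.
  + by move=> x; rewrite /w /z /= {1}(qE x); ring.
Qed.

(** A signed measure that changes sign under both reflections vanishes, unless
    their product has finite order. *)
Theorem two_reflections_eq :
  (0 <= c < 1 -> forall k, (0 < k)%N -> double_angle c ^+ k != 1) ->
  forall A, measurable A -> m1 A = m2 A.
Proof.
move=> aper A mA.
suff h : agree_on m1 m2 setT by exact: h.
have [c0|c0] := ltP c 0; first by apply: hyperbolic; nra.
have [c1|c1|c1] := ltgtP c 1.
- by apply: elliptic; [rewrite c0|apply: aper; rewrite c0].
- by apply: hyperbolic; nra.
- exact: parabolic.
Qed.

End two_reflections.

(** * Null sets *)

Lemma poly_roots_countable (R : realType) (P : {poly R}) :
  P != 0 -> countable [set t | P.[t] = 0].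
Proof.
move=> P0; apply: finite_set_countable; apply: contrapT.
move=> /(infinite_set_fset (size P))[F FP]; apply/negP; rewrite -ltnNge.
apply: max_poly_roots => //; last exact: finmap.fset_uniq.
by apply/allP => t tF; apply/eqP; exact: FP.
Qed.

(** A nonzero function on [R ^ n] whose restriction to each line is polynomial
    has a Lebesgue-negligible zero set. *)
Lemma lebesgue_zero_set (R : realType) n (f : 'rV[R]_n -> R) :
  measurable_fun setT (f : Rd R n -> R) ->
  (forall x w, exists P : {poly R}, forall t, f (x + t *: w) = P.[t]) ->
  (exists x, f x != 0) ->
  lebesgue_rV R n [set x | f x = 0] = 0%E.
Proof.
elim: n f => [|n IH] f mf hf [x0 fx0] /=.
  rewrite diracE memNset//= => f0; move: fx0.
  by rewrite (_ : x0 = 0) ?f0 ?eqxx//; apply/rowP; case.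
rewrite /cons_measure /pushforward.
pose cons t (y : 'rV[R]_n) : 'rV[R]_n.+1 := @cons_rV R n (t, y).
have cons0 t y : cons t y 0 0 = t := cons_rV0 (t, y).
have consS t y i : cons t y 0 (lift 0 i) = y 0 i := cons_rVS (t, y) i.
have consE t y t' y' r :
    cons (t + r * t') (y + r *: y') = cons t y + r *: cons t' y'.
  apply/rowP => i; rewrite [RHS]mxE [X in _ = _ + X]mxE.
  by case: (unliftP 0 i) => [j ->|->]; rewrite ?consS ?cons0// !mxE.
set A := _ @^-1` _.
have mA : measurable A.
  rewrite -[X in measurable X]setTI; apply: measurable_cons_rV => //.
  rewrite (_ : [set _ | _] = f @^-1` [set 0])//.
  by rewrite -[X in measurable X]setTI; exact: mf.
pose t0 := (uncons_rV x0).1; pose y0 := (uncons_rV x0).2.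
have x0E : cons t0 y0 = x0.
  apply/rowP => i; case: (unliftP 0 i) => [j ->|->].
    by rewrite consS mxE.
  by rewrite cons0.
(* The slices through [t] are null, by induction, unless [t] is a root of the
   restriction [P] of [f] to the line through [x0]. *)
have [P fP] := hf (cons 0 y0) (cons 1 0).
have fcons t : f (cons t y0) = P.[t].
  by rewrite -fP -consE mulr1 add0r scaler0 addr0.
have P0 : P != 0.
  by apply: contraNneq fx0 => P0; rewrite -x0E fcons P0 horner0.
rewrite /product_measure1 (@ae_eq_integral _ _ _ _ _ (cst 0%E))//.
- by rewrite integral0.
- exact: measurable_fun_xsection.
exists [set t | P.[t] = 0]; split.
- exact/countable_measurable/poly_roots_countable.
- exact/countable_lebesgue_measure0/poly_roots_countable.
move=> t /= nt; apply: contrapT => Pt; apply: nt => _ /=.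
rewrite (_ : xsection A t = [set y | f (cons t y) = 0]).
  apply: IH.
  - apply: (measurableT_comp mf).
    exact: (measurableT_comp (@measurable_cons_rV R n) (measurable_pair1 t)).
  - move=> y w; have [S fS] := hf (cons t y) (cons 0 w).
    by exists S => r; rewrite -fS -consE mulr0 addr0.
  - by exists y0; rewrite fcons; apply/eqP.
by apply/seteqP; split => y /=; rewrite xsectionE.
Qed.

(** If a nonzero function is polynomial on each line and homogeneous of degree 2,
    then the trace of its zero set on the sphere is negligible, because the cone
    over that trace lies in the zero set. *)
Lemma surface_zero_set (R : realType) n (f : 'rV[R]_n -> R) :
  measurable_fun setT (f : Rd R n -> R) ->
  (forall x w, exists P : {poly R}, forall t, f (x + t *: w) = P.[t]) ->
  (forall r x, f (r *: x) = r ^+ 2 * f x) ->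
  (exists x, f x != 0) ->
  surface_measure [set x | f x = 0] = 0%E.
Proof.
move=> mf hf fZ f0; rewrite /surface_measure.
have mA : measurable ([set x | f x = 0] : set (Rd R n)).
  rewrite (_ : [set _ | _] = f @^-1` [set 0])//.
  by rewrite -[X in measurable X]setTI; exact: mf.
rewrite (_ : lebesgue_rV _ _ _ = 0%E) ?mule0//.
apply/eqP; rewrite eq_le measure_ge0 andbT.
rewrite -(lebesgue_zero_set mf hf f0); apply: le_measure; rewrite ?inE//.
  rewrite (_ : [set _ | _] = @enorm R n @^-1` `]0, 1]%classic `&`
      @direction R n @^-1` [set x | f x = 0]); last first.
    by apply/seteqP; split => x /=; rewrite in_itv.
  apply: measurableI; rewrite -[X in measurable X]setTI.
    exact: measurable_enorm.
  exact: measurable_direction.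
move=> x /= [/andP[x0 _]] /eqP; rewrite fZ mulf_eq0 expf_eq0/= invr_eq0.
by rewrite (gt_eqF x0) => /eqP.
Qed.

Section exceptional_pairs.
Context (R : realType) (d : nat) (B : {symmetric 'rV[R]_d}).

Let measurable_form2 d1 (T1 : measurableType d1) (f g : T1 -> Rd R d) :
  measurable_fun setT f -> measurable_fun setT g ->
  measurable_fun setT (fun x => B (f x) (g x)).
Proof.
move=> mf mg.
rewrite (_ : (fun _ => _) =
    fun x => \sum_(i < d) (f x : 'rV[R]_d) 0 i * B (delta_mx 0 i) (g x));
  last first.
  apply/funext => x; rewrite {1}[f x]row_sum_delta.
  have add0 : B 0 (g x) = 0 by rewrite -(scale0r 0) formZl mul0r.
  rewrite (big_morph (B ^~ (g x)) (fun y z => formDl B y z (g x)) add0).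
  by apply: eq_bigr => i _; rewrite formZl.
apply: measurable_sum => i; apply: measurable_funM.
  by apply: (measurableT_comp (@measurable_coord R d i)).
under eq_fun do rewrite formC.
exact: (measurableT_comp (measurable_formr B (delta_mx 0 i))).
Qed.

(** The pairs of directions whose squared cosine with respect to the form [B]
    is [c]; the equation is cleared of denominators, hence weaker when
    [B p.2 p.2 = 0]. *)
Definition cos2_set (c : R) : set (Rd R d * Rd R d) :=
  [set p | B p.1 p.1 != 0 /\ B p.1 p.2 ^+ 2 = c * (B p.1 p.1 * B p.2 p.2)].

Lemma measurable_cos2_set c : measurable (cos2_set c).
Proof.
have m11 : measurable_fun setT (fun p : Rd R d * Rd R d => B p.1 p.1).
  by apply: measurable_form2; exact: measurable_fst.
have m22 : measurable_fun setT (fun p : Rd R d * Rd R d => B p.2 p.2).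
  by apply: measurable_form2; exact: measurable_snd.
have m12 : measurable_fun setT (fun p : Rd R d * Rd R d => B p.1 p.2).
  by apply: measurable_form2; [exact: measurable_fst|exact: measurable_snd].
pose f (p : Rd R d * Rd R d) : R :=
  B p.1 p.2 ^+ 2 - c * (B p.1 p.1 * B p.2 p.2).
have mf : measurable_fun setT f.
  apply: measurable_funB.
    by under eq_fun do rewrite expr2; exact: measurable_funM.
  by apply: measurable_funM; [exact: measurable_cst|exact: measurable_funM].
rewrite (_ : cos2_set c =
    (fun p => B p.1 p.1) @^-1` (~` [set 0]) `&` f @^-1` [set 0]); last first.
  apply/seteqP; split => p /= [/eqP h1 h2]; split => //.
    by rewrite /f h2 subrr.
  by apply/eqP; rewrite -subr_eq0; apply/eqP.
apply: measurableI; rewrite -[X in measurable X]setTI.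
  by apply: m11 => //; exact: measurableC.
exact: mf.
Qed.

(** For fixed [u1], the condition on [u2] is a quadratic equation, which is not
    satisfied by [u1] itself. *)
Lemma cos2_set_null c : c != 1 ->
  (@surface_measure R d \x @surface_measure R d)%E (cos2_set c) = 0%E.
Proof.
move=> c1; rewrite /product_measure1; apply: integral0_eq => u _ /=.
have [a0|a0] := eqVneq (B u u) 0.
  rewrite (_ : xsection _ _ = set0) ?measure0//.
  by apply/seteqP; split => // y /xsectionP[/=]; rewrite a0 eqxx.
pose f (y : 'rV[R]_d) : R := B u y ^+ 2 - c * (B u u * B y y).
rewrite (_ : xsection _ _ = [set y | f y = 0]); last first.
  apply/seteqP; split => y.
    by move=> /xsectionP[_ /= h]; rewrite /f h subrr.
  move=> /= /eqP; rewrite /f subr_eq0 => /eqP h.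
  by apply/xsectionP; split.
apply: surface_zero_set.
- apply: measurable_funB.
    under eq_fun do rewrite expr2.
    by apply: measurable_funM; apply: measurable_form2 => //;
      exact: measurable_cst.
  apply: measurable_funM; first exact: measurable_cst.
  by apply: measurable_funM; [exact: measurable_cst|exact: measurable_form].
- move=> x w.
  exists (((B u x)%:P + (B u w) *: 'X) ^+ 2 - (c * B u u) *:
    ((B x x)%:P + (2 * B x w) *: 'X + (B w w) *: 'X^2)) => t.
  rewrite !hornerE /f !formDr !formDl !formZr !formZl (formC B w x) /=.
  by ring.
- by move=> r x; rewrite /f !formZr !formZl; ring.
- exists u; rewrite /f (_ : _ - _ = (1 - c) * B u u ^+ 2); last by ring.
  by rewrite mulf_neq0 ?sqrf_eq0// subr_eq0 eq_sym.
Qed.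

(** The exceptional pairs: those for which the product of the two reflections
    acts as a rotation of finite order. *)
Definition exceptional_pairs : set (Rd R d * Rd R d) :=
  [set p | [/\ sphere p.1, sphere p.2, p.1 <> p.2 :> 'rV[R]_d &
      p.1 <> - (p.2 : 'rV[R]_d) :> 'rV[R]_d] /\
    let c := B p.1 p.2 ^+ 2 / (B p.1 p.1 * B p.2 p.2) in
    [/\ B p.1 p.1 != 0, B p.2 p.2 != 0, 0 <= c < 1 &
      exists2 k, (0 < k)%N & double_angle c ^+ k = 1]].

Lemma exceptional_pairs_negligible :
  (@surface_measure R d \x @surface_measure R d)%E.-negligible
    exceptional_pairs.
Proof.
(* The values [c_ k j] of [c] are determined by the roots of unity. *)
pose P k : {poly R[i]} := 'X^(k.+1) - 1.
pose rs k : seq R[i] := projT1 (closed_field_poly_normal (P k)).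
have rsP k (l : R[i]) : l ^+ k.+1 = 1 -> l \in rs k.
  move=> lk; have PE := projT2 (closed_field_poly_normal (P k)).
  have P0 : lead_coef (P k) != 0.
    by rewrite lead_coef_eq0 -size_poly_eq0 size_XnsubC.
  rewrite -root_prod_XsubC -(rootZ _ _ P0) -PE.
  by apply/eqP; rewrite !hornerE lk subrr.
pose c_ k j : R := (complex.Re (nth 0 (rs k) j) + 1) / 2.
pose N k j := if c_ k j == 1 then set0 else cos2_set (c_ k j).
have nN k j :
    (@surface_measure R d \x @surface_measure R d)%E.-negligible (N k j).
  rewrite /N; case: eqP => [_|/eqP c1]; first exact: negligible_set0.
  exists (cos2_set (c_ k j)); split => //; first exact: measurable_cos2_set.
  exact: cos2_set_null.
apply: (@negligibleS _ _ _ _ (\bigcup_k \bigcup_j N k j)); last first.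
  by apply: negligible_bigcup => k; apply: negligible_bigcup => j; exact: nN.
move=> [u1 u2] [_ /= [a0 b0 /andP[c0 c1] [[//|k] _ ck]]].
exists k => //.
exists (index (double_angle (B u1 u2 ^+ 2 / (B u1 u1 * B u2 u2))) (rs k)) => //.
rewrite /N /c_ nth_index; last exact: rsP.
rewrite /double_angle /= subrK mulrAC divff// mul1r ifF; last by rewrite lt_eqF.
by split => //=; field; rewrite a0 b0.
Qed.

End exceptional_pairs.

(** * Heisenberg uniqueness pairs *)

Lemma sphere_collinear (R : realType) d (u w : 'rV[R]_d) r :
  sphere u -> sphere w -> u = r *: w -> u = w \/ u = - w.
Proof.
move=> /dot_sphere u1 /dot_sphere w1 uE; move: u1.
rewrite uE dotZr dotC dotZr w1 mulr1 -expr2 => /eqP.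
rewrite sqrf_eq1 => /orP[] /eqP ->; first by left; rewrite scale1r.
by right; rewrite scaleN1r.
Qed.

Lemma hyperplane_measurable (R : realType) d (u : 'rV[R]_d) :
  measurable (hyperplane u : set (Rd R d)).
Proof.
rewrite (_ : hyperplane u =
  (fun x : Rd R d => dot (x : 'rV[R]_d) u) @^-1` [set 0])//.
by rewrite -[X in measurable X]setTI; exact: measurable_dotr.
Qed.

Section jordan.
Context (R : realType) d (T : measurableType d).
Context (mu : {charge set T -> \bar R}) (P N : set T).
Variable hahn : hahn_decomposition mu P N.

Lemma jordan_null (D : set T) : measurable D -> mu.-null_set D ->
  jordan_pos hahn D = 0%E /\ jordan_neg hahn D = 0%E.
Proof.
move=> mD D0; have [[mP _] [mN _] _ _] := hahn.
rewrite jordan_posE jordan_negE cjordan_posE cjordan_negE /crestr0 mem_set//.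
rewrite /crestr.
have nD (A : set T) : measurable A -> mu (D `&` A) = 0%E.
  by move=> mA; apply: D0; [exact: measurableI|move=> x []].
by rewrite !nD// oppe0.
Qed.

Lemma jordan_eq0 (A : set T) : measurable A ->
  jordan_pos hahn A = jordan_neg hahn A -> mu A = 0%E.
Proof.
move=> mA pn; rewrite (jordan_decomp hahn mA) /cadd /= cscaleN1 pn subee//.
exact: fin_num_measure.
Qed.

End jordan.

Theorem theorem1p2 (R : realType) (d : nat) (hd : (2 <= d)%N)
    (Q : 'rV[R]_d -> R) (hQ : is_quadratic_form Q)
    (v : 'rV[R]_d) (rho : R) :
  exists E : set (Rd R d * Rd R d),
    [/\ (forall u1 u2 : 'rV[R]_d, E (u1, u2) ->
           [/\ sphere u1, sphere u2, u1 <> u2 & u1 <> - u2]),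
        (@surface_measure R d \x @surface_measure R d)%E.-negligible E &
        forall u1 u2 : 'rV[R]_d, sphere u1 -> sphere u2 ->
          u1 <> u2 -> u1 <> - u2 -> Q u1 <> 0 -> Q u2 <> 0 ->
          ~ E (u1, u2) ->
          heisenberg_uniqueness_pair (quadric Q v rho)
            (hyperplane u1 `|` hyperplane u2)].
Proof.
have [B QB] := hQ.
have SE : quadric Q v rho = [set x | qpoly B v x = rho].
  by apply/seteqP; split => x /=; rewrite /quadric /= /qpoly QB.
have mS : measurable (quadric Q v rho : set (Rd R d)).
  by rewrite SE; exact: measurable_quadric.
exists (exceptional_pairs B); split.
- by move=> u1 u2 [].
- exact: exceptional_pairs_negligible.
move=> u1 u2 s1 s2 u12 u12N /eqP; rewrite QB => a0 /eqP; rewrite QB => b0 nE.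
split => //.
  by apply: measurableU; exact: hyperplane_measurable.
move=> mu muS fmu A mA.
set h := projT2 (cid (projT2 (cid (Hahn_decomposition mu)))).
pose m1 : {finite_measure set (Rd R d) -> \bar R} := jordan_pos h.
pose m2 : {finite_measure set (Rd R d) -> \bar R} := jordan_neg h.
apply: (jordan_eq0 (hahn := h) mA).
have [z1 z2] := jordan_null h (measurableC mS) muS.
have fcos xi : (hyperplane u1 `|` hyperplane u2) xi ->
    diff_integral m1 m2 (fun x => cos (dot x xi)) = 0.
  by move=> /fmu/(congr1 (@complex.Re R)).
have fsin xi : (hyperplane u1 `|` hyperplane u2) xi ->
    diff_integral m1 m2 (fun x => sin (dot x xi)) = 0.
  by move=> /fmu/(congr1 (@complex.Im R)).
rewrite SE in z1 z2.
apply: (@two_reflections_eq _ _ B v u1 u2 a0 b0 _ m1 m2) mA.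
- move=> r /(sphere_collinear s1 s2)[] //.
- by apply: (diff_integral_refl z1 z2 s1 a0) => xi hxi;
    [apply: fcos|apply: fsin]; left.
- by apply: (diff_integral_refl z1 z2 s2 b0) => xi hxi;
    [apply: fcos|apply: fsin]; right.
- move=> c01 k k0; apply/eqP => ck; apply: nE; split => //.
  by split => //; exists k.
Qed.
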